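(* Let $U$ be either $[0,1]$ or $\{0,1\}$. For a pair $(A,B)$ of $2\times2$ real Hurwitz matrices, consider the switched system $$\dot x(t)=u(t)Ax(t)+(1-u(t))Bx(t),\qquad x\in\mathbb{R}^2,\quad u(\cdot):[0,\infty[\to U\ \text{measurable}.$$ For each of the two choices of $U$, there is no integer $m$ such that every globally uniformly exponentially stable (GUES) system of this form admits a common Lyapunov function which is a piecewise polynomial function of total degree at most $m$. In other words, the minimum total degree of a piecewise polynomial common Lyapunov function cannot be uniformly bounded over the set of all GUES systems of this form.
   Context: A real matrix is Hurwitz if all its eigenvalues have strictly negative real part. GUES: there exist constants $M,\lambda>0$ such that every solution $x(\cdot)$ of the system, for every measurable $u(\cdot):[0,\infty[\to U$ and every initial condition $x(0)=x_0\in\mathbb{R}^2$, satisfies $\|x(t)\|\le Me^{-\lambda t}\|x_0\|$ for all $t>0$. Common Lyapunov function (CLF): a continuous function $V:\mathbb{R}^2\to\mathbb{R}^+$ that is positive definite ($V(0)=0$ and $V(x)>0$ for all $x\neq0$) and strictly decreasing along every nonconstant trajectory of the system (for every measurable $u(\cdot):[0,\infty[\to U$). Piecewise polynomial function (PPF) on $\mathbb{R}^2$: a continuous function $V:\mathbb{R}^2\to\mathbb{R}$ together with a finite number $q$ of cones $K_1,\dots,K_q$ based at the origin and partitioning $\mathbb{R}^2$ (in the plane, each cone is identified by a pair of angles), such that $V$ is a polynomial function of degree $d_j$ on $K_j$, $1\le j\le q$. Its total degree is $m(V):=\max\{q,d_1,\dots,d_q\}$. *)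

(* Defs.v *)
From HB Require Import structures.
From mathcomp Require Import all_boot all_order all_algebra.
(* The notations of mpoly clash with those of the analysis library. *)
From mathcomp.multinomials Require Import -(notations) mpoly.
From mathcomp Require Import all_classical all_reals all_analysis.
From mathcomp Require Import complex.

Set Implicit Arguments.
Unset Strict Implicit.
Unset Printing Implicit Defensive.

Import Order.TTheory GRing.Theory Num.Theory.
Import numFieldNormedType.Exports.

Local Open Scope classical_set_scope.
Local Open Scope ring_scope.

Definition hurwitz (R : realType) (A : 'M[R]_2) : Prop :=
  forall z : R[i], eigenvalue (map_mx (real_complex R) A) z -> complex.Re z < 0.

(* The Euclidean norm; the library norm `|x| on matrices is the sup norm. *)
Definition enorm (R : realType) (x : 'cV[R]_2) : R :=
  Num.sqrt (\sum_i x i ord0 ^+ 2).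

(* Absolute continuity on the compact interval [a, b]. *)
Definition abs_continuous (R : realType) (W : normedModType R) (a b : R)
    (f : R -> W) : Prop :=
  forall e : R, 0 < e -> exists2 d : R, 0 < d &
    forall (n : nat) (s t : 'I_n -> R),
      (forall i, a <= s i /\ s i <= t i /\ t i <= b) ->
      trivIset setT (fun i => `]s i, t i[%classic) ->
      \sum_i (t i - s i) < d -> \sum_i `|f (t i) - f (s i)| < e.

(* Time functions are total on R; only their values on [0, +oo[ matter. *)
Definition admissible (R : realType) (U : set R) (u : R -> R) : Prop :=
  measurable_fun (`[0, +oo[%classic : set R) u /\ forall t, 0 <= t -> U (u t).

(* Solutions in the sense of Caratheodory: the input being merely measurable,
   the equation is required at almost every time. *)
Definition solution (R : realType) (A B : 'M[R]_2) (u : R -> R)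
    (x : R -> 'cV[R]_2) : Prop :=
  (forall T : R, 0 <= T -> abs_continuous 0 T x) /\
  {ae lebesgue_measure, forall t : R, 0 < t ->
     is_derive t (1 : R) x (u t *: (A *m x t) + (1 - u t) *: (B *m x t))}.

Definition GUES (R : realType) (U : set R) (A B : 'M[R]_2) : Prop :=
  exists M lambda : R, 0 < M /\ 0 < lambda /\
    forall (u : R -> R) (x : R -> 'cV[R]_2),
      admissible U u -> solution A B u x ->
      forall t : R, 0 < t -> enorm (x t) <= M * expR (- lambda * t) * enorm (x 0).

Definition nonconstant (R : realType) (x : R -> 'cV[R]_2) : Prop :=
  ~ exists c, forall t, 0 <= t -> x t = c.

Definition CLF (R : realType) (U : set R) (A B : 'M[R]_2)
    (V : 'cV[R]_2 -> R) : Prop :=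
  [/\ continuous V,
      V 0 = 0,
      forall x, x != 0 -> 0 < V x
    & forall (u : R -> R) (x : R -> 'cV[R]_2),
        admissible U u -> solution A B u x -> nonconstant x ->
        forall s t : R, 0 <= s -> s < t -> V (x t) < V (x s)].

Definition polar (R : realType) (r theta : R) : 'cV[R]_2 :=
  \col_i (if i == ord0 then r * cos theta else r * sin theta).

(* The cone with apex at the origin delimited by a pair of angles.  It is
   half-open so that cones can partition the plane, except for the apex, which
   belongs to all of them. *)
Definition cone (R : realType) (alpha beta : R) : set 'cV[R]_2 :=
  [set x | exists r theta : R,
     [/\ 0 <= r, alpha <= theta, theta < beta & x = polar r theta]].

(* The cones and polynomials are part of the data: they determine the degree. *)
Record ppf (R : realType) := PPF {
  ppf_fun :> 'cV[R]_2 -> R;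
  ppf_ncones : nat;
  ppf_angles : 'I_ppf_ncones -> R * R;
  ppf_poly : 'I_ppf_ncones -> mpoly.mpoly 2 R;
  ppf_continuous : continuous ppf_fun;
  ppf_angles_lt : forall j, (ppf_angles j).1 < (ppf_angles j).2;
  ppf_angles_le : forall j, (ppf_angles j).2 <= (ppf_angles j).1 + 2 * pi;
  ppf_cover : forall x, exists j, cone (ppf_angles j).1 (ppf_angles j).2 x;
  ppf_disjoint : forall j k x, j != k ->
    cone (ppf_angles j).1 (ppf_angles j).2 x ->
    cone (ppf_angles k).1 (ppf_angles k).2 x -> x = 0;
  ppf_polyE : forall j x, cone (ppf_angles j).1 (ppf_angles j).2 x ->
    ppf_fun x = mpoly.meval (fun i => x i ord0) (ppf_poly j)
}.

(* msize p is one plus the degree of p. *)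
Definition total_degree (R : realType) (V : ppf R) : nat :=
  maxn (ppf_ncones V) (\max_(j < ppf_ncones V) (mpoly.msize (ppf_poly j)).-1)%N.

(* Main.v *)
Require Import Defs.
From HB Require Import structures.
From mathcomp Require Import all_boot all_order all_algebra.
From mathcomp.multinomials Require Import -(notations) mpoly.
From mathcomp Require Import all_classical all_reals all_analysis.
From mathcomp Require Import measurable_realfun complex ring lra.
Import Order.TTheory GRing.Theory Num.Theory.
Import numFieldNormedType.Exports.
Local Open Scope classical_set_scope.
Local Open Scope ring_scope.

(** With [q] the root in ]0, 1[ of q^4 - 2 q^3 - 2 q + 1 and [J] a suitable
    linear map with J^2 = -1, the switched system given by A = diag(-2, -1) and
    B = J A J^-1 has a closed trajectory formed of arcs of four parabolas: A
    leads from (1, 1) to J (1, 1), then B leads to - (1, 1), and so on.  The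
    region that it bounds is the unit ball of a norm which no solution
    increases, so that for every eta > 0 the pair (A - eta, B - eta) is GUES,
    while its trajectory from s (1, 1) comes back to r s (1, 1) with r tending
    to 1 as eta tends to 0.  A common Lyapunov function which is piecewise
    polynomial of degree at most m therefore varies, for a suitable small s, by
    a factor at least r^(m+1) along this trajectory, that is by almost nothing.
    On the other hand, some cone contains a portion of the first arc of a
    length bounded below in terms of m; there the function is a combination of
    decaying exponentials in time without constant term, which cannot be
    almost constant. *)

(** * Two estimates: sums of geometric sequences, and polynomials near 0 *)

(* The operator f |-> (fun k => f k.+1 - mu * f k) removes the term of ratio mu,
   multiplies constants by 1 - mu and at most doubles the error. *)
Lemma geometric_sum_gap (R : realFieldType) (a d : R) (s : seq (R * R)) :
    (forall p, p \in s -> 0 <= p.2 <= 1) ->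
    (forall k, (k <= size s)%N -> `|\sum_(p <- s) p.1 * p.2 ^+ k - a| <= d) ->
  `|a| * \prod_(p <- s) (1 - p.2) <= 2 ^+ size s * d.
Proof.
move eqn : (size s) => n.
elim: n s eqn a d => [|n IHn] [|[c mu] s] //= => [_|[sz]] a d hs hf.
  by rewrite big_nil mulr1 expr0 mul1r; have := hf 0 erefl; rewrite big_nil sub0r normrN.
have /andP[mu0 mu1] : 0 <= mu <= 1 by apply: (hs (c, mu)); rewrite mem_head.
pose s' := [seq (p.1 * (p.2 - mu), p.2) | p <- s].
rewrite big_cons /= mulrA exprSr -mulrA.
suff : `|a * (1 - mu)| * \prod_(p <- s') (1 - p.2) <= 2 ^+ n * (2 * d).
  by rewrite big_map /= normrM (ger0_norm (_ : 0 <= 1 - mu)) //; lra.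
apply: IHn; first by rewrite size_map; case: sz.
  by move=> p /mapP[p' p's ->] /=; apply: hs; rewrite in_cons p's orbT.
move=> k kn; rewrite big_map /=.
have := hf k (leq_trans kn (leqnSn _)); have := hf k.+1 kn; rewrite !big_cons /= => h1 h0.
have -> : \sum_(j <- s) j.1 * (j.2 - mu) * j.2 ^+ k - a * (1 - mu) =
   (c * mu ^+ k.+1 + \sum_(p <- s) p.1 * p.2 ^+ k.+1 - a) -
   mu * (c * mu ^+ k + \sum_(p <- s) p.1 * p.2 ^+ k - a).
  rewrite (eq_bigr (fun p => p.1 * p.2 ^+ k.+1 - mu * (p.1 * p.2 ^+ k))); last by move=> p _; rewrite exprS; ring.
  by rewrite sumrB -mulr_sumr exprS; ring.
apply: le_trans (ler_normB _ _) _; rewrite normrM (ger0_norm mu0).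
have := normr_ge0 (c * mu ^+ k + \sum_(p <- s) p.1 * p.2 ^+ k - a).
nra.
Qed.

(** Near 0 the lowest-order term dominates: if d is the order of vanishing at 0, then d is at most
    [n] and p(rho s) / p(s) tends to rho^d. The spare factor [rho] in [rho ^+ n.+1] absorbs the
    error. *)
Lemma polynomial_small_scale (R : realType) (p : {poly R}) (n : nat) (rho : R) :
    (size p <= n.+1)%N -> (forall s, 0 < s -> 0 < p.[s]) -> 0 < rho < 1 ->
  exists2 s, 0 < s & rho ^+ n.+1 * p.[s] <= p.[rho * s].
Proof.
move=> szp ppos /andP[rho0 rho1].
have p0 : p != 0 by apply/eqP => p0; have := ppos 1 ltr01; rewrite p0 horner0 ltxx.
have [d [r r0 pE]] := multiplicity_XsubC p 0; rewrite p0 /= subr0 in r0 pE.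
have pe s : p.[s] = r.[s] * s ^+ d by rewrite pE hornerM horner_exp hornerX.
have dn : (d <= n)%N.
  have rn0 : r != 0 by apply: contraNneq p0 => r00; rewrite pE r00 mul0r.
  rewrite -ltnS; apply: leq_trans szp; rewrite pE size_Mmonic ?monicXn // size_polyXn addnS /=.
  by rewrite -[X in (X < _)%N]add0n ltn_add2r size_poly_gt0.
have cont (g : {poly R}) : 0 < g.[0] -> \forall s \near (0 : R), 0 < g.[s].
  move=> g0; have c0 : {for 0, continuous (horner g)}.
    by apply/differentiable_continuous/derivable1_diffP; have [] := is_derive_poly g 0.
  exact: (cvgr_gt _ c0).
have near0 (P : R -> Prop) : (\forall s \near (0 : R), P s) -> exists2 s, 0 < s & P s.
  move=> /nbhs_ballP[e /= e0 he]; exists (e / 2); first lra.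
  by apply: he; rewrite /ball /= sub0r normrN ger0_norm; lra.
have r00 : 0 < r.[0].
  rewrite lt_def; move: r0; rewrite rootE => -> /=; rewrite leNgt; apply/negP => rneg.
  have := cont (- r); rewrite hornerN oppr_gt0 => /(_ rneg)/near0[s s0].
  rewrite hornerN oppr_gt0 => rs; have := ppos s s0; rewrite pe.
  by rewrite pmulr_lgt0 ?exprn_gt0// => /lt_trans - /(_ _ rs); rewrite ltxx.
have : 0 < (r \Po (rho *: 'X) - rho *: r).[0].
  by rewrite hornerD hornerN hornerZ horner_comp hornerZ hornerX mulr0 -[X in _ < X - _]mul1r -mulrBl mulr_gt0// subr_gt0.
move=> /cont/near0[s s0]; rewrite hornerD hornerN hornerZ horner_comp hornerZ hornerX => h.
exists s => //; rewrite !pe exprMn.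
have h1 : rho ^+ n.+1 <= rho ^+ d.+1 by apply: ler_wiXn2l; rewrite ?ltnS//; lra.
have h2 := ppos s s0; rewrite pe in h2.
apply: le_trans (ler_wpM2r (ltW h2) h1) _.
rewrite exprS; have -> : rho * rho ^+ d * (r.[s] * s ^+ d) = (rho * r.[s]) * (rho ^+ d * s ^+ d) by ring.
apply: ler_wpM2r; first by rewrite mulr_ge0 ?exprn_ge0 ?ltW.
lra.
Qed.

(** * Absolutely continuous functions with bounded slope *)

(** Real induction: the supremum of the times where [P] holds can always be crossed. It stands for a
    compactness argument in which the local step depends on the nature of the point [c]. *)
Lemma segment_induction (R : realType) (a b : R) (P : R -> Prop) :
    a <= b -> P a ->
    (forall c, a <= c <= b -> exists2 d, 0 < d &
       forall s t, a <= s -> t <= b -> c - d < s -> s <= c -> c <= t -> t < c + d ->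
         P s -> P t) ->
  P b.
Proof.
move=> ab Pa step; pose S := [set t | a <= t <= b /\ P t].
have Sa : S a by split=> //; rewrite lexx ab.
have supS : has_sup S by split; [exists a | exists b => t [/andP[_ ?] _]].
have acb : a <= sup S <= b.
  by rewrite (ub_le_sup supS.2 Sa) (sup_le_ub supS.1)// => t [/andP[]].
have [d d0 stepc] := step _ acb.
have [s [/andP[as_ sb] Ps] cds] := sup_adherent d0 supS.
have sc : s <= sup S by apply: (ub_le_sup supS.2); split=> //; rewrite as_ sb.
move/andP: acb => [ac cb].
have Pt t : t <= b -> sup S <= t -> t < sup S + d -> P t.
  by move=> tb ct tcd; apply: (stepc s t).
have [bcd|bcd] := ltP b (sup S + d); first exact: Pt.
have : sup S + d / 2 <= sup S.
  apply: (ub_le_sup supS.2); split; first by lra.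
  by apply: Pt; lra.
lra.
Qed.

Section disjoint_intervals.
Variables (R : realType) (l : seq (R * R)).
Hypothesis l_le : forall p, p \in l -> p.1 <= p.2.
Hypothesis l_disj : pairwise (fun p p' : R * R => p'.2 <= p.1) l.

Lemma pairwise_trivIset : trivIset setT
  (fun i : 'I_(size l) => `](nth (0, 0) l i).1, (nth (0, 0) l i).2[%classic).
Proof.
apply/trivIsetP => i j _ _; wlog ij : i j / (i < j)%N => [hw|_].
  rewrite neq_lt => /orP[] ij; first by apply: hw => //; rewrite neq_lt ij.
  by rewrite setIC; apply: hw => //; rewrite neq_lt ij.
have /(pairwiseP (0, 0)) := l_disj => /(_ i j (ltn_ord i) (ltn_ord j) ij) h.
rewrite -subset0 => x [] /=; rewrite !in_itv /= => /andP[h1 _] /andP[_ h2].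
lra.
Qed.

Lemma sum_length_lt (O : set R) (d : R) : measurable O ->
    (lebesgue_measure O < d%:E)%E ->
    (forall p, p \in l -> `]p.1, p.2[%classic `<=` O) ->
  \sum_(p <- l) (p.2 - p.1) < d.
Proof.
move=> mO Od lO; rewrite -lte_fin; apply: le_lt_trans Od.
rewrite (big_nth (0, 0)) big_mkord.
have mem i : (i < size l)%N -> nth (0, 0) l i \in l by exact: mem_nth.
rewrite -sumEFin.
have lenE (i : 'I_(size l)) : ((nth (0, 0) l i).2 - (nth (0, 0) l i).1)%:E =
    lebesgue_measure (`](nth (0, 0) l i).1, (nth (0, 0) l i).2[%classic : set R).
  rewrite lebesgue_measure_itv /= lte_fin.
  have := l_le _ (mem i (ltn_ord i)); rewrite le_eqVlt => /orP[/eqP ->|->//].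
  by rewrite ltxx subrr.
rewrite (eq_bigr _ (fun i _ => lenE i)) -measure_semi_additive_ord //.
- apply: le_measure; rewrite ?inE//; first exact: bigsetU_measurable.
  elim/big_ind : _ => [|X Y XO YO|i _]; first exact: sub0set.
    by rewrite subUset.
  exact: (lO _ (mem i (ltn_ord i))).
- exact: pairwise_trivIset.
- exact: bigsetU_measurable.
Qed.

End disjoint_intervals.

(* Both one-sided upper derivatives of f at t are at most c. *)
Definition slope_le (R : realType) (f : R -> R) (t c : R) : Prop :=
  forall e, 0 < e -> \forall s \near t, (s - t) * (f s - f t) <= (c + e) * (s - t) ^+ 2.

(* Intervals around the exceptional points are chosen inside an open set of
   small measure, where absolute continuity bounds the total variation. *)
Lemma ae_slope_le_increment (R : realType) (f : R -> R) (a b c : R) : a <= b ->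
    abs_continuous a b f ->
    {ae lebesgue_measure, forall t : R, a < t < b -> slope_le R f t c} ->
  f b - f a <= c * (b - a).
Proof.
move=> ab acf [A [mA A0 nA]]; rewrite leNgt; apply/negP => gap.
(* The total error is less than [e * K]: at most e (b - a) from the slopes, [e] from the variation
   on the exceptional intervals and (|c| + 1) e from their length. *)
pose K := (b - a) + `|c| + 2.
have K0 : 0 < K by rewrite /K; have := normr_ge0 c; lra.
pose e := Num.min 1 ((f b - f a - c * (b - a)) / K / 2).
have e0 : 0 < e by rewrite lt_min ltr01/= divr_gt0// divr_gt0// subr_gt0.
have [d d0 acd] := acf e e0.
(* The slope is controlled strictly between [a] and [b] only, so the endpoints join the exceptional
   set. *)
pose A' := A `|` [set a] `|` [set b].
have mA' : measurable A' by apply: measurableU => //; apply: measurableU.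
have A'0 : lebesgue_measure A' = 0%E.
  have [m1 m2] : measurable [set a] /\ measurable [set b] by [].
  have s1 x : lebesgue_measure [set x : R] = 0%E by exact: lebesgue_measure_set1.
  by rewrite (measureU0 (measurableU _ _ mA m1) m2 (s1 b)) (measureU0 mA m1 (s1 a)).
have de0 : 0 < Num.min d e by rewrite lt_min d0.
have A'oo : (lebesgue_measure A' < +oo)%E by rewrite A'0.
have [G [oG A'G]] := lebesgue_regularity_outer mA' A'oo de0.
move=> GA'; have mG : measurable G by exact: open_measurable.
have Gde : (lebesgue_measure G < (Num.min d e)%:E)%E.
  by rewrite -(setDUK A'G) setUC measureU0 //; exact: measurableD.
(* Sweep from [a] to [t]: [l] collects the exceptional intervals, latest first, and the pair
   [(t, t)] forces them to end by [t]. The slope bound is charged on these intervals too; the terms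
   in |c + e| compensate for it when [c + e] is negative. *)
pose P t := exists l : seq (R * R), [/\ pairwise (fun p p' : R * R => p'.2 <= p.1) ((t, t) :: l),
  (forall p, p \in l -> a <= p.1 <= p.2), (forall p, p \in l -> `]p.1, p.2[%classic `<=` G) &
  f t - f a <= (c + e) * (t - a) + \sum_(p <- l) (`|f p.2 - f p.1| + `|c + e| * (p.2 - p.1))].
have extend t s l : s <= t -> pairwise (fun p p' : R * R => p'.2 <= p.1) ((s, s) :: l) ->
    pairwise (fun p p' : R * R => p'.2 <= p.1) ((t, t) :: l).
  move=> st /= /andP[/allP sl ->]; rewrite andbT; apply/allP => p /sl /= ps.
  exact: le_trans ps st.
have [l [dl al Ol]] : P b.
  apply: (segment_induction _ a) => //.
    by exists [::]; split=> //; rewrite big_nil !subrr mulr0 addr0.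
  move=> u /andP[au ub]; have [uG|uG] := pselect (G u).
    have /nbhs_ballP[r /= r0 ball_r] : nbhs u G by exact: open_nbhs_nbhs.
    exists r => // s t as_ tb us su ut tu [l [dl al Ol fl]]; exists ((s, t) :: l); split.
    - rewrite /= lexx /=; move: (dl) => /= /andP[sl ->]; rewrite sl /= andbT.
      apply/allP => p pl; move/allP: sl => /(_ p pl) /=; lra.
    - by move=> p; rewrite in_cons => /orP[/eqP -> /=|/al//]; lra.
    - move=> p; rewrite in_cons => /orP[/eqP -> /=|/Ol//] x /=.
      rewrite in_itv /= => sxt; apply: ball_r; rewrite /ball /= ltr_norml; lra.
    - rewrite big_cons /=; have := ler_norm (f t - f s).
      have := ler_norm (- (c + e)); rewrite normrN => ce ft.
      have : - (c + e) * (t - s) <= `|c + e| * (t - s) by rewrite ler_wpM2r//; lra.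
      lra.
  (* Outside [G] the slope bound holds at [u]; it is used on both sides, from [s] to [u] and from
     [u] to [t]. *)
  have nA'u : ~ A' u by move=> /A'G.
  have aub : a < u < b.
    by rewrite !lt_neqAle au ub !andbT; apply/andP; split; apply/eqP => ?; apply: nA'u; [left; right|right].
  have : slope_le R f u c.
    by apply: contrapT => ns; apply: nA'u; left; left; apply: nA => /(_ aub).
  move=> /(_ e e0)/nbhs_ballP[r /= r0 ball_r].
  exists r => // s t as_ tb us su ut tu [l [dl al Ol fl]]; exists l; split => //.
    by apply: extend dl; lra.
  have hs : (s - u) * (f s - f u) <= (c + e) * (s - u) ^+ 2.
    by apply: ball_r; rewrite /ball /= ltr_norml; lra.
  have ht : (t - u) * (f t - f u) <= (c + e) * (t - u) ^+ 2.
    by apply: ball_r; rewrite /ball /= ltr_norml; lra.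
  have {}hs : f u - f s <= (c + e) * (u - s).
    move: su; rewrite le_eqVlt => /orP[/eqP ->|su]; first by rewrite !subrr mulr0.
    by rewrite -(ler_pM2l (_ : 0 < u - s)); lra.
  have {}ht : f t - f u <= (c + e) * (t - u).
    move: ut; rewrite le_eqVlt => /orP[/eqP ->|ut]; first by rewrite !subrr mulr0.
    by rewrite -(ler_pM2l (_ : 0 < t - u)); lra.
  lra.
have ple p : p \in l -> p.1 <= p.2 by move=> /al /andP[].
move: dl => /= /andP[/allP bl dl] fb.
have len := sum_length_lt _ _ ple dl _ _ mG Gde Ol.
have len_d : \sum_(p <- l) (p.2 - p.1) < d by rewrite (lt_le_trans len)// ge_min lexx.
have len_e : \sum_(p <- l) (p.2 - p.1) < e by rewrite (lt_le_trans len)// ge_min lexx orbT.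
have := acd (size l) (fun i => (nth (0, 0) l i).1) (fun i => (nth (0, 0) l i).2) _ (pairwise_trivIset _ _ dl).
have bn (F : R * R -> R) : \sum_(i < size l) F (nth (0, 0) l i) = \sum_(p <- l) F p.
  by rewrite [RHS](big_nth (0, 0)) big_mkord.
rewrite (bn (fun p => p.2 - p.1)) (bn (fun p => `|f p.2 - f p.1|)) => /(_ _ len_d) var.
have {}var : \sum_(p <- l) `|f p.2 - f p.1| < e.
  apply: var => i; have pl : nth (0, 0) l i \in l by exact: mem_nth.
  by have := al _ pl; have /= := bl _ pl; split; [lra|split; lra].
move: fb; rewrite big_split /= -mulr_sumr => fb.
have e1 : e <= 1 by rewrite ge_min lexx.
have eK : 2 * (e * K) <= f b - f a - c * (b - a).
  have : e <= (f b - f a - c * (b - a)) / K / 2 by rewrite ge_min lexx orbT.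
  rewrite ler_pdivlMr// ler_pdivlMr//; lra.
have ce : `|c + e| <= `|c| + 1.
  by apply: le_trans (ler_normD _ _) _; rewrite lerD2l gtr0_norm.
have : `|c + e| * \sum_(p <- l) (p.2 - p.1) <= (`|c| + 1) * e.
  apply: ler_pM => //; last exact: ltW.
  by rewrite big_seq sumr_ge0 // => p /ple; rewrite subr_ge0.
have := mulr_gt0 e0 K0; move: eK; rewrite /K; lra.
Qed.

(** * Derivatives, slope bounds and exponential decay *)

Lemma is_deriveP (R : realType) (W : normedModType R) (f : R -> W) (t : R) (df : W) :
  is_derive t (1 : R) f df <->
  forall e, 0 < e -> \forall s \near t, `|f s - f t - (s - t) *: df| <= e * `|s - t|.
Proof.
have eqv : (fun h => h^-1 *: ((f \o shift t) (h *: (1 : R)) - f t)) @ 0^' --> df <->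
    forall e, 0 < e -> \forall s \near t, `|f s - f t - (s - t) *: df| <= e * `|s - t|.
  split=> [/cvgrPdist_le|] h.
    move=> e /h /nbhs_ballP[d /= d0 hd]; apply/nbhs_ballP; exists d => //= s.
    rewrite /ball /= distrC => st.
    have [->|st0] := eqVneq s t; first by rewrite !subrr scale0r subr0 !normr0 mulr0.
    have st0' : s - t != 0 by rewrite subr_eq0.
    have := hd (s - t); rewrite /ball /= sub0r normrN => /(_ st st0').
    rewrite /shift /= scaler1 subrK => hs.
    have -> : f s - f t - (s - t) *: df = - ((s - t) *: (df - (s - t)^-1 *: (f s - f t))).
      by rewrite scalerBr scalerA divff// scale1r opprB.
    by rewrite normrN normrZ mulrC ler_wpM2r.
  apply/cvgrPdist_le => e /h /nbhs_ballP[d /= d0 hd]; apply/nbhs_ballP; exists d => //= s.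
  rewrite /ball /= sub0r normrN => sd s0; rewrite /shift /= scaler1.
  have := hd (s + t); rewrite /ball /= distrC addrK => /(_ sd) hs.
  have -> : df - s^-1 *: (f (s + t) - f t) = - (s^-1 *: (f (s + t) - f t - s *: df)).
    by rewrite [in RHS]scalerBr scalerA mulVf// scale1r opprB.
  by rewrite normrN normrZ normfV mulrC ler_pdivrMr ?normr_gt0.
rewrite -eqv; split=> [[+ <-]|h]; first by [].
by split; [apply/cvg_ex; exists df|apply/cvg_lim].
Qed.

Lemma is_derive_coord (R : realType) (n : nat) (x : R -> 'cV[R]_n) (t : R) (v : 'cV[R]_n) :
  is_derive t (1 : R) x v <-> forall i, is_derive t (1 : R) (fun s => x s i ord0) (v i ord0).
Proof.
split=> [/is_deriveP h i|h]; apply/is_deriveP => e e0.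
  move: (h e e0); apply: filterS => s; apply: le_trans.
  have -> : x s i ord0 - x t i ord0 - (s - t) *: v i ord0 = (x s - x t - (s - t) *: v) i ord0.
    by rewrite !mxE.
  by rewrite [leRHS]/Num.norm /= mx_normrE; apply/bigmax_geP; right; exists (i, ord0).
have hi (i : 'I_n) := (is_deriveP _ _ _ _ _).1 (h i) e e0.
have := @filter_forall R _ (fun i s => `|x s i ord0 - x t i ord0 - (s - t) *: v i ord0| <= e * `|s - t|)
  (nbhs t) _ hi.
move=> /(_ _)-/filterS; apply => s hs; rewrite [leLHS]/Num.norm /= mx_normrE; apply/bigmax_leP; split=> [|[i j] _ /=].
  by rewrite mulr_ge0 // ltW.
by rewrite !mxE (ord1 j).
Qed.

Lemma coord_le_norm (R : realType) (n : nat) (x : 'cV[R]_n) i : `|x i ord0| <= `|x|.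
Proof. by rewrite [leRHS]/Num.norm /= mx_normrE; apply/bigmax_geP; right; exists (i, ord0). Qed.

Lemma slope_leW (R : realType) (f : R -> R) (t c c' : R) : c <= c' ->
  slope_le R f t c -> slope_le R f t c'.
Proof.
move=> cc' h e /h; apply: filterS => s /le_trans; apply.
by rewrite ler_wpM2r ?sqr_ge0// lerD2r.
Qed.

Lemma is_derive_slope_le (R : realType) (f : R -> R) (t c : R) :
  is_derive t (1 : R) f c -> slope_le R f t c.
Proof.
move=> /is_deriveP h e /h; apply: filterS => s.
have -> : (s - t) * (f s - f t) = (s - t) * (f s - f t - (s - t) * c) + c * (s - t) ^+ 2 by ring.
move=> hs; suff : (s - t) * (f s - f t - (s - t) * c) <= e * (s - t) ^+ 2 by lra.
rewrite -(real_normK (num_real (s - t))) expr2 mulrA.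
by apply: le_trans (ler_norm _) _; rewrite normrM mulrC; exact: ler_wpM2r.
Qed.

(** An upper bound on slopes survives any choice, point by point, between two functions that satisfy
    it. This handles [spiral] on the half-axes, where two smooth expressions meet. *)
Lemma slope_le_select (R : realType) (f g1 g2 : R -> R) (t c : R) :
    (\forall s \near t, f s = g1 s \/ f s = g2 s) -> g1 t = f t -> g2 t = f t ->
  slope_le R g1 t c -> slope_le R g2 t c -> slope_le R f t c.
Proof.
move=> fg g1t g2t h1 h2 e e0; have {h1} := h1 e e0; have {h2} := h2 e e0; move: fg.
by apply: filterS3 => s [] ->; rewrite g1t g2t.
Qed.

Lemma abs_continuous_comp (R : realType) (W : normedModType R) (V : W -> R) (L a b : R)
    (x : R -> W) : (forall y z, `|V y - V z| <= L * `|y - z|) ->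
  abs_continuous a b x -> abs_continuous a b (V \o x).
Proof.
move=> VL acx e e0; pose K := Num.max L 1.
have K0 : 0 < K by rewrite lt_max ltr01 orbT.
have [d d0 h] := acx (e / K) (divr_gt0 e0 K0); exists d => // n s t st dj len.
apply: (@le_lt_trans _ _ (K * \sum_i `|x (t i) - x (s i)|)).
  rewrite mulr_sumr; apply: ler_sum => i _; apply: le_trans (VL _ _) _.
  by rewrite ler_wpM2r// le_max lexx.
by rewrite mulrC -ltr_pdivlMr//; exact: h.
Qed.

Lemma lebesgue_ae_impl (R : realType) (P Q : R -> Prop) : (forall t, P t -> Q t) ->
  {ae lebesgue_measure, forall t : R, P t} -> {ae lebesgue_measure, forall t : R, Q t}.
Proof.
move=> PQ [A [mA A0 nPA]]; exists A; split => // t nQt.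
by apply: nPA => Pt; apply: nQt; exact: PQ.
Qed.

(** As [f] need not be differentiable, Gronwall's argument is discretized: since [f] is
    nonincreasing, a time step h divides it by at least 1 + eta h, and this is at least exp(eta h /
    2) when eta h <= 1. Hence the halved rate. *)
Lemma slope_le_exp_decay (R : realType) (f : R -> R) (eta : R) : 0 < eta ->
    (forall t, 0 <= f t) -> (forall T, 0 <= T -> abs_continuous 0 T f) ->
    {ae lebesgue_measure, forall t : R, 0 < t -> slope_le R f t (- (eta * f t))} ->
  forall t, 0 < t -> f t <= expR (- (eta / 2) * t) * f 0.
Proof.
move=> eta0 f0 acf aef.
have ac s t : 0 <= s -> s <= t -> abs_continuous s t f.
  move=> s0 st e e0; have [d d0 h] := acf t (le_trans s0 st) e e0; exists d => // n a b hab.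
  by apply: h => i; have [? [? ?]] := hab i; split=> //; exact: le_trans s0 _.
have mono s t : 0 <= s -> s <= t -> f t <= f s.
  move=> s0 st; rewrite -subr_le0 -(mul0r (t - s)); apply: ae_slope_le_increment => //; first exact: ac.
  apply: lebesgue_ae_impl aef => u hu /andP[su _]; apply: slope_leW (hu (le_lt_trans s0 su)).
  by rewrite oppr_le0 mulr_ge0// ltW.
have step s t : 0 <= s -> s <= t -> f t * (1 + eta * (t - s)) <= f s.
  move=> s0 st; have : f t - f s <= - (eta * f t) * (t - s).
    apply: ae_slope_le_increment => //; first exact: ac.
    apply: lebesgue_ae_impl aef => u hu /andP[su ut]; apply: slope_leW (hu (le_lt_trans s0 su)).
    rewrite lerN2 ler_pM2l//; apply: mono; lra.
  lra.
(* Enough steps are taken to have eta h <= 1. *)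
move=> t t0; pose n := (Num.truncn (eta * t)).+1.
have n0 : 0 < n%:R :> R by rewrite ltr0n.
pose h := t / n%:R; have h0 : 0 < h by exact: divr_gt0.
have nh : eta * h <= 1.
  by rewrite /h mulrA ler_pdivrMr// mul1r ltW// truncnS_gt.
have expb : expR (eta * h / 2) <= 1 + eta * h.
  have y0 : 0 < eta * h by rewrite mulr_gt0.
  move: y0 nh; set y := eta * h => y0 y1.
  have := expR_ge1Dx (- (y / 2)); rewrite expRN => e1.
  rewrite -[expR _]invrK invf_ple ?posrE ?invr_gt0 ?expR_gt0 //; last lra.
  apply: le_trans e1; rewrite -[leLHS]mul1r ler_pdivrMr; nra.
have it k : f (k%:R * h) * expR (eta * h / 2) ^+ k <= f 0.
  elim: k => [|k IHk]; first by rewrite mul0r expr0 mulr1.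
  apply: le_trans IHk; rewrite exprS mulrA ler_wpM2r// ?exprn_ge0 ?expR_ge0//.
  have kh : 0 <= k%:R * h by rewrite mulr_ge0// ltW.
  have khS : k.+1%:R * h = k%:R * h + h by rewrite -natr1; ring.
  rewrite khS; apply: le_trans (step _ (k%:R * h + h) kh _); last by rewrite lerDl ltW.
  by rewrite ler_wpM2l// addrAC subrr add0r.
have := it n; rewrite -expRM_natl /h mulrC.
have -> : n%:R * (t / n%:R) = t by rewrite mulrC divfK// gt_eqF.
have -> : n%:R * (eta * (t / n%:R) / 2) = eta / 2 * t by field; rewrite gt_eqF.
by rewrite mulNr expRN mulrC ler_pdivlMl ?expR_gt0// mulrC.
Qed.

(** * The Lyapunov norm of the marginal system *)

(* In the eigencoordinates y1 = q a + b and y2 = q^2 a + b, whose eigenvalues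
   are -1 and -2, this is y1^2 / y2, which is constant on the trajectories.
   At the origin, 0 / 0 = 0 is the right value. *)
Definition corner (R : realType) (q a b : R) : R := (q * a + b) ^+ 2 / (q ^+ 2 * a + b).

(* [corner] extended from the first quadrant to the plane by rotation: in each
   quadrant one term is the intended value, one is 0, and the two others reduce
   to |a| and |b|. *)
Definition spiral (R : realType) (q a b : R) : R :=
  corner R q (Num.max 0 a) (Num.max 0 b) + corner R q (Num.max 0 (- a)) (Num.max 0 (- b)) +
  corner R q (Num.max 0 (- b)) (Num.max 0 a) + corner R q (Num.max 0 b) (Num.max 0 (- a)) -
  `|a| - `|b|.

Section spiral.
Variables (R : realType) (q : R).
Hypotheses (q0 : 0 < q) (q1 : q < 1) (qE : q ^+ 4 - 2 * q ^+ 3 - 2 * q + 1 = 0).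
Local Notation F := (corner R q).
Local Notation V := (spiral R q).

Lemma corner00 : F 0 0 = 0.
Proof. by rewrite /corner !mulr0 addr0 expr0n mul0r. Qed.

Lemma corner0r b : F 0 b = b.
Proof.
have [->|b0] := eqVneq b 0; first exact: corner00.
by rewrite /corner !mulr0 add0r expr2 mulfK.
Qed.

Lemma corner0l a : F a 0 = a.
Proof.
have [->|a0] := eqVneq a 0; first exact: corner00.
rewrite /corner !addr0; field; by rewrite a0 gt_eqF.
Qed.

Lemma spiral_rot a b : V (- b) a = V a b.
Proof. rewrite /spiral opprK normrN; lra. Qed.

Lemma spiral_Q1 a b : 0 <= a -> 0 <= b -> V a b = F a b.
Proof.
move=> a0 b0; rewrite /spiral !(max_l (_ : - _ <= 0)) ?oppr_le0// !max_r//.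
by rewrite corner00 corner0r corner0l !ger0_norm//; lra.
Qed.

(** Completing the square shows y1^2 / y2 to be the largest of the functions 2 u y1 - u^2 y2, which
    are linear in (a, b). Estimates thus need no derivative of [corner], not even at the origin. *)
Lemma corner_ge a b u : 0 <= a -> 0 <= b ->
  2 * u * (q * a + b) - u ^+ 2 * (q ^+ 2 * a + b) <= F a b.
Proof.
move=> a0 b0; rewrite /corner; have q20 : 0 < q ^+ 2 by rewrite exprn_gt0.
have : 0 <= q ^+ 2 * a + b by rewrite addr_ge0// mulr_ge0// ltW.
rewrite le_eqVlt => /orP[/eqP y2|y2].
  have qa : 0 <= q ^+ 2 * a by rewrite mulr_ge0// ltW.
  have b00 : b = 0 by lra.
  have /eqP : q ^+ 2 * a = 0 by lra.
  rewrite mulf_eq0 gt_eqF//= => /eqP ->.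
  by rewrite b00 !mulr0 !addr0 !mulr0 subr0 expr0n mul0r.
rewrite ler_pdivlMr// -subr_ge0.
have -> : (q * a + b) ^+ 2 - (2 * u * (q * a + b) - u ^+ 2 * (q ^+ 2 * a + b)) * (q ^+ 2 * a + b) =
  (q * a + b - u * (q ^+ 2 * a + b)) ^+ 2 by ring.
exact: sqr_ge0.
Qed.

(** The maximum is at u = y1 / y2, and q y1 <= y2 gives u <= 1 / q. If y2 = 0, then a = b = 0 and
    any [u] would do. *)
Lemma corner_attained a b : 0 <= a -> 0 <= b -> exists2 u, 0 <= u <= q^-1 &
  F a b = 2 * u * (q * a + b) - u ^+ 2 * (q ^+ 2 * a + b).
Proof.
move=> a0 b0; rewrite /corner; have q20 : 0 < q ^+ 2 by rewrite exprn_gt0.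
have qa : 0 <= q ^+ 2 * a by rewrite mulr_ge0// ltW.
have : 0 <= q ^+ 2 * a + b by rewrite addr_ge0// mulr_ge0// ltW.
rewrite le_eqVlt => /orP[/eqP y2|y2].
  have b00 : b = 0 by lra.
  have /eqP : q ^+ 2 * a = 0 by lra.
  rewrite mulf_eq0 gt_eqF//= => /eqP ->.
  exists 0; first by rewrite lexx invr_ge0 ltW.
  by rewrite b00 !mulr0 !addr0 !mulr0 subr0 expr0n mul0r.
exists ((q * a + b) / (q ^+ 2 * a + b)); last by field; rewrite gt_eqF.
apply/andP; split.
  by apply: divr_ge0 (ltW y2); rewrite addr_ge0// mulr_ge0// ltW.
rewrite ler_pdivrMr// mulrDr expr2 !mulrA mulVf ?gt_eqF// mul1r lerD2l.
by rewrite ler_peMl// invf_ge1// ltW.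
Qed.

(** Keep the [u] that is optimal at (a, b): at (a', b') it still gives a lower bound, so the
    difference is at most a linear form whose coefficients are controlled by u <= 1 / q. *)
Lemma corner_lipschitz a b a' b' : 0 <= a -> 0 <= b -> 0 <= a' -> 0 <= b' ->
  F a b - F a' b' <= 3 / q ^+ 2 * (`|a - a'| + `|b - b'|).
Proof.
move=> a0 b0 a'0 b'0; have [u /andP[u0 uq] ->] := corner_attained _ _ a0 b0.
have := corner_ge _ _ u a'0 b'0.
have p0 : 0 < q^-1 by rewrite invr_gt0.
have p1 : 1 <= q^-1 by rewrite invf_ge1// ltW.
have -> : 3 / q ^+ 2 = 3 * q^-1 ^+ 2 by rewrite exprVn.
have qp : q * q^-1 = 1 by rewrite mulfV// gt_eqF.
have uq1 : 0 <= u * q <= 1.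
  by rewrite mulr_ge0 ?(ltW q0)//= -(mulVf (lt0r_neq0 q0)) ler_wpM2r ?(ltW q0).
move: p0 p1 uq; set p := q^-1; clearbody p => p0 p1 up h.
have n1 := ler_norm (a - a'); have n2 := ler_norm (b - b').
have n3 := ler_norm (- (a - a')); have n4 := ler_norm (- (b - b')).
rewrite !normrN in n3 n4; move: n1 n2 n3 n4.
set x := `|a - a'|; set y := `|b - b'| => n1 n2 n3 n4.
have x0 : 0 <= x by rewrite /x. have y0 : 0 <= y by rewrite /y.
clearbody x y.
apply: (@le_trans _ _ ((2 * (u * q) + (u * q) ^+ 2) * x + (2 * u + u ^+ 2) * y)).
  suff : (2 * (u * q) - (u * q) ^+ 2) * (a - a') + (2 * u - u ^+ 2) * (b - b') <=
     (2 * (u * q) + (u * q) ^+ 2) * x + (2 * u + u ^+ 2) * y by lra.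
  have bnd (v z w : R) : 0 <= v -> z <= w -> - z <= w -> (2 * v - v ^+ 2) * z <= (2 * v + v ^+ 2) * w.
    by move=> v0 zw nzw; have := sqr_ge0 v; nra.
  by apply: lerD; apply: bnd => //; case/andP: uq1.
have h1 : 2 * (u * q) + (u * q) ^+ 2 <= 3 * p ^+ 2.
  by have /andP[] := uq1; set v := u * q; nra.
have h2 : 2 * u + u ^+ 2 <= 3 * p ^+ 2 by nra.
by rewrite mulrDr lerD// ler_wpM2r.
Qed.

Lemma quadrant_ind (P : R -> R -> Prop) : (forall a b, P (- b) a -> P a b) ->
  (forall a b, 0 <= a -> 0 <= b -> P a b) -> forall a b, P a b.
Proof.
move=> rot Q1 a b; have [a0|a0] := leP 0 a; have [b0|b0] := leP 0 b; first exact: Q1.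
- by apply/rot/Q1 => //; lra.
- by apply/rot/rot/rot/Q1; lra.
- by apply/rot/rot/Q1; lra.
Qed.

(** Each of the four [corner] terms contributes 3 / q^2, and the two absolute values together
    contribute 1. *)
Lemma spiral_lipschitz a b a' b' :
  `|V a b - V a' b'| <= (12 / q ^+ 2 + 1) * (`|a - a'| + `|b - b'|).
Proof.
have mx (x y : R) : `|Num.max 0 x - Num.max 0 y| <= `|x - y|.
  have h1 := ler_norm (x - y); have := ler_norm (- (x - y)); rewrite normrN => h2.
  rewrite ler_norml; have := normr_ge0 (x - y).
  by case: (leP 0 x) => hx; case: (leP 0 y) => hy; lra.
have mx0 (x : R) : 0 <= Num.max 0 x by rewrite le_max lexx.
have mxN (x y : R) : `|Num.max 0 (- x) - Num.max 0 (- y)| <= `|x - y|.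
  by apply: le_trans (mx _ _) _; rewrite -opprD normrN.
have c0 : 0 <= 3 / q ^+ 2 by rewrite divr_ge0// exprn_ge0// ltW.
wlog suff one : a b a' b' / V a b - V a' b' <= (12 / q ^+ 2 + 1) * (`|a - a'| + `|b - b'|).
  by rewrite ler_norml one andbT lerNl opprB (distrC a) (distrC b).
have lip x y x' y' : 0 <= x -> 0 <= y -> 0 <= x' -> 0 <= y' ->
    `|x - x'| + `|y - y'| <= `|a - a'| + `|b - b'| ->
    F x y - F x' y' <= 3 / q ^+ 2 * (`|a - a'| + `|b - b'|).
  move=> x0 y0 x'0 y'0 h; apply: le_trans (corner_lipschitz _ _ _ _ x0 y0 x'0 y'0) _.
  exact: ler_wpM2l.
have l1 := lip _ _ _ _ (mx0 a) (mx0 b) (mx0 a') (mx0 b') (lerD (mx _ _) (mx _ _)).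
have l2 := lip _ _ _ _ (mx0 (- a)) (mx0 (- b)) (mx0 (- a')) (mx0 (- b')) (lerD (mxN _ _) (mxN _ _)).
have l3 : F (Num.max 0 (- b)) (Num.max 0 a) - F (Num.max 0 (- b')) (Num.max 0 a') <=
    3 / q ^+ 2 * (`|a - a'| + `|b - b'|).
  by apply: lip => //; rewrite addrC lerD.
have l4 : F (Num.max 0 b) (Num.max 0 (- a)) - F (Num.max 0 b') (Num.max 0 (- a')) <=
    3 / q ^+ 2 * (`|a - a'| + `|b - b'|).
  by apply: lip => //; rewrite addrC lerD.
have na : `|a'| - `|a| <= `|a - a'| by rewrite distrC lerB_dist.
have nb : `|b'| - `|b| <= `|b - b'| by rewrite distrC lerB_dist.
have -> : 12 / q ^+ 2 = 4 * (3 / q ^+ 2) by lra.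
by rewrite /spiral; lra.
Qed.

Lemma spiral_ge a b : q ^+ 2 * (`|a| + `|b|) <= V a b.
Proof.
move: a b; apply: quadrant_ind => [a b|a b a0 b0]; first by rewrite spiral_rot normrN addrC.
(* The choice u = 1 gives (2 q - q^2) a + b. *)
rewrite spiral_Q1// !ger0_norm//; apply: le_trans (corner_ge _ _ 1 a0 b0).
have h1 : q ^+ 2 * a <= q * a by rewrite ler_wpM2r// expr2 ler_piMl// ltW.
have h2 : q ^+ 2 * b <= b by rewrite ler_piMl// exprn_ile1// ltW.
lra.
Qed.

Lemma spiral00 : V 0 0 = 0.
Proof. by rewrite spiral_Q1// corner00. Qed.

Lemma spiral_le a b : V a b <= (12 / q ^+ 2 + 1) * (`|a| + `|b|).
Proof.
have := spiral_lipschitz a b 0 0; rewrite spiral00 !subr0; apply: le_trans.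
exact: ler_norm.
Qed.

(* The equations of motion in the coordinates (a, b), in which J exchanges the
   two vector fields. *)
Definition switched_flow (eta u : R) (a b : R -> R) (t : R) : Prop :=
  is_derive t (1 : R) a
    ((u * ((2 * q - 1) * a t + q^-1 * b t) + (1 - u) * ((q - 2) * a t + q ^+ 2 * b t)) / (1 - q)
     - eta * a t) /\
  is_derive t (1 : R) b
    ((u * (- q ^+ 2 * a t + (q - 2) * b t) + (1 - u) * (- q^-1 * a t + (2 * q - 1) * b t)) / (1 - q)
     - eta * b t).

(** The quarter turn exchanges the two vector fields, so the input becomes [1 - u]. Every quadrant
    is thereby reduced to the first. *)
Lemma switched_flow_rot (eta u : R) (a b : R -> R) (t : R) : switched_flow eta u a b t ->
  switched_flow eta (1 - u) (fun s => - b s) a t.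
Proof.
by move=> [ha hb]; split; [apply: is_derive_eq (is_deriveN hb) _|apply: is_derive_eq ha _]; lra.
Qed.

(** [corner] is constant along the first vector field and homogeneous of degree 1, so the shift by
    [eta] accounts for the right-hand side, and only the second field, weighted by [1 - u], has to
    be estimated. *)
Lemma switched_flow_corner (eta u : R) (a b : R -> R) (t : R) : 0 <= u <= 1 -> switched_flow eta u a b t ->
    0 <= a t -> 0 <= b t -> 0 < a t + b t ->
  slope_le R (fun s => F (a s) (b s)) t (- (eta * F (a t) (b t))).
Proof.
move=> /andP[u0 u1] [ha hb] a0 b0 ab0.
have y2 : 0 < q ^+ 2 * a t + b t.
  have q20 : 0 < q ^+ 2 by rewrite exprn_gt0.
  move: a0; rewrite le_eqVlt => /orP[/eqP a00|a0]; first by rewrite -a00 mulr0 add0r; lra.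
  by rewrite ltr_wpDr// mulr_gt0.
have y20 : q ^+ 2 * a t + b t != 0 by rewrite gt_eqF.
set da := (_ / (1 - q) - eta * a t) in ha; set db := (_ / (1 - q) - eta * b t) in hb.
have h1 : is_derive t (1:R) (fun s => q * a s + b s) (q * da + db) by apply: is_deriveD.
have h2 : is_derive t (1:R) (fun s => q ^+ 2 * a s + b s) (q ^+ 2 * da + db) by apply: is_deriveD.
have h3 := @is_deriveV R (fun s => q ^+ 2 * a s + b s) _ _ _ y20 h2.
have h4 : is_derive t (1:R) (fun s => (q * a s + b s) ^+ 2) (2 * (q * a t + b t) * (q * da + db)).
  by apply: is_derive_eq (is_deriveX 2 h1) _ ; rewrite /= expr1.
apply: slope_leW (is_derive_slope_le _ _ _ _ (is_deriveM h4 h3)).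
have qq : 1 - q != 0 by rewrite gt_eqF// subr_gt0.
have q00 : q != 0 by rewrite gt_eqF.
(* By the equation of q, the second vector field decreases [corner] at a rate
   proportional to a b: on the axes the two vector fields are parallel. *)
have -> : (q * a t + b t) ^+ 2 *: (- (q ^+ 2 * a t + b t) ^- 2 *: (q ^+ 2 * da + db)) +
    (q ^+ 2 * a t + b t)^-1 *: (2 * (q * a t + b t) * (q * da + db)) =
    - (eta * F (a t) (b t)) + (1 - u) / (1 - q) * (q * a t + b t) * ((q ^+ 5 + 3 * q ^+ 3 - 3 * q - q^-1) * (a t * b t)
     + (a t ^+ 2 - b t ^+ 2) * (q ^+ 4 - 2 * q ^+ 3 - 2 * q + 1)) /
    (q ^+ 2 * a t + b t) ^+ 2.
  by rewrite /GRing.scale /= /corner /da /db; field; rewrite y20 qq q00.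
rewrite qE mulr0 addr0 gerDl; apply: mulr_le0_ge0; last by rewrite invr_ge0 exprn_ge0// ltW.
apply: mulr_ge0_le0.
  apply: mulr_ge0; first by rewrite divr_ge0// subr_ge0// ltW.
  by rewrite addr_ge0// mulr_ge0// ltW.
apply: mulr_le0_ge0 (mulr_ge0 a0 b0).
have p1 : 1 <= q^-1 by rewrite invf_ge1// ltW.
have q3 : q ^+ 3 <= q by rewrite exprS ler_piMr ?(ltW q0)// expr_le1 ?(ltW q0) ?(ltW q1).
have q5 : q ^+ 5 <= 1 by rewrite exprn_ile1// ltW.
by clear -p1 q3 q5; lra.
Qed.

(** On the half-axis b = 0, [spiral] is [corner] of (a, b) on one side and of (- b, a) on the other;
    both obey the bound, the second one by rotation. *)
Lemma switched_flow_spiral_Q1 (eta u : R) (a b : R -> R) (t : R) : 0 <= u <= 1 -> switched_flow eta u a b t ->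
    0 < a t -> 0 <= b t ->
  slope_le R (fun s => V (a s) (b s)) t (- (eta * V (a t) (b t))).
Proof.
move=> u01 h a0 b0; rewrite (spiral_Q1 _ _ (ltW a0) b0).
have slope1 := switched_flow_corner _ _ _ _ _ u01 h (ltW a0) b0 (ltr_wpDr b0 a0).
have cont (g : R -> R) (d : R) : is_derive t (1 : R) g d -> 0 < g t -> \forall s \near t, 0 < g s.
  move=> [dg _] gt0; have c0 : {for t, continuous g} by exact/differentiable_continuous/derivable1_diffP.
  exact: (cvgr_gt _ c0).
have neara := cont _ _ h.1 a0.
move: b0; rewrite le_eqVlt => /orP[/eqP b0|b0].
  have u01' : 0 <= 1 - u <= 1 by lra.
  have Nb0 : 0 <= - b t by rewrite -b0 oppr0.
  have pos : 0 < - b t + a t by rewrite -b0 oppr0 add0r.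
  have slope2 := switched_flow_corner _ _ _ _ _ u01' (switched_flow_rot _ _ _ _ _ h) Nb0 (ltW a0) pos.
  apply: slope_le_select slope1 _.
  - apply: filterS neara => s as0; have [bs|bs] := leP 0 (b s).
      by left; rewrite spiral_Q1// ltW.
    by right; rewrite -spiral_rot spiral_Q1 ?(ltW as0)//; lra.
  - by rewrite spiral_Q1// -?b0// ltW.
  - by rewrite /= -b0 oppr0 corner0r spiral_Q1 ?(ltW a0)// corner0l.
  - by move: slope2; rewrite -b0 oppr0 corner0r corner0l.
apply: (slope_le_select _ _ _ _ _ _ _ _ _ slope1 slope1); last 2 first.
- by rewrite spiral_Q1 ?ltW.
- by rewrite spiral_Q1 ?ltW.
apply: filterS2 neara (cont _ _ h.2 b0) => s as0 bs0; left.
by rewrite spiral_Q1// ltW.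
Qed.

Lemma switched_flow_spiral (eta u : R) (a b : R -> R) (t : R) : 0 <= u <= 1 -> switched_flow eta u a b t ->
  slope_le R (fun s => V (a s) (b s)) t (- (eta * V (a t) (b t))).
Proof.
have rot v c d : switched_flow eta v c d t ->
    slope_le R (fun s => V (- d s) (c s)) t (- (eta * V (- d t) (c t))) ->
    slope_le R (fun s => V (c s) (d s)) t (- (eta * V (c t) (d t))).
  by move=> _; under eq_fun do rewrite spiral_rot; rewrite spiral_rot.
move=> u01 h; have u01' : 0 <= 1 - u <= 1 by lra.
have u01'' : 0 <= 1 - (1 - u) <= 1 by lra.
have u01''' : 0 <= 1 - (1 - (1 - u)) <= 1 by lra.
have h1 := switched_flow_rot _ _ _ _ _ h; have h2 := switched_flow_rot _ _ _ _ _ h1.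
have h3 := switched_flow_rot _ _ _ _ _ h2.
have [a0|a0|a0] := ltgtP (a t) 0.
- have [b0|b0] := leP (b t) 0.
    by apply: (rot _ _ _ h); apply: (rot _ _ _ h1); apply: switched_flow_spiral_Q1 u01'' h2 _ _; lra.
  by apply: (rot _ _ _ h); apply: (rot _ _ _ h1); apply: (rot _ _ _ h2); apply: switched_flow_spiral_Q1 u01''' h3 _ _; lra.
- have [b0|b0] := leP 0 (b t).
    exact: switched_flow_spiral_Q1 u01 h _ _.
  by apply: (rot _ _ _ h); apply: switched_flow_spiral_Q1 u01' h1 _ _; lra.
have [b0|b0|b0] := ltgtP (b t) 0.
- by apply: (rot _ _ _ h); apply: switched_flow_spiral_Q1 u01' h1 _ _; lra.
- by apply: (rot _ _ _ h); apply: (rot _ _ _ h1); apply: (rot _ _ _ h2); apply: switched_flow_spiral_Q1 u01''' h3 _ _; lra.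
(* At the origin both coordinates have derivative 0, so the Lipschitz bound makes [spiral]
   negligible with respect to s - t. *)
rewrite a0 b0 spiral00 mulr0 oppr0 => e e0.
pose L : R := 12 / q ^+ 2 + 1.
have L0 : 0 < L by rewrite ltr_wpDl// divr_ge0// exprn_ge0// ltW.
have e2 : 0 < e / (2 * L) by rewrite divr_gt0// mulr_gt0.
have da : is_derive t (1 : R) a 0 by apply: is_derive_eq h.1 _; rewrite a0 b0; ring.
have db : is_derive t (1 : R) b 0 by apply: is_derive_eq h.2 _; rewrite a0 b0; ring.
move/is_deriveP: da => /(_ _ e2) da; move/is_deriveP: db => /(_ _ e2) db.
apply: filterS2 da db => s; rewrite a0 b0 !subr0 !scaler0 !subr0 => has hbs.
rewrite spiral00 subr0 add0r.
have Ve : `|V (a s) (b s)| <= e * `|s - t|.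
  rewrite ger0_norm; last by apply: le_trans (spiral_ge _ _); rewrite mulr_ge0 ?addr_ge0// exprn_ge0// ltW.
  apply: le_trans (spiral_le _ _) _; rewrite -/L.
  apply: (@le_trans _ _ (L * (2 * (e / (2 * L) * `|s - t|)))); first by rewrite ler_wpM2l ?(ltW L0)//; lra.
  by rewrite le_eqVlt; apply/orP; left; apply/eqP; field; rewrite gt_eqF.
apply: le_trans (ler_norm _) _; rewrite normrM -(real_normK (num_real (s - t))) expr2 mulrA.
by rewrite mulrC ler_wpM2r.
Qed.

End spiral.

(** * The switched systems *)

Section plane.
Variable R : realType.

Definition col2 (x y : R) : 'cV[R]_2 := \col_i (if i == ord0 then x else y).
Definition mx22 (a b c d : R) : 'M[R]_2 :=
  \matrix_(i, j) (if i == ord0 then if j == ord0 then a else b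
                  else if j == ord0 then c else d).

Lemma ord2P (P : 'I_2 -> Prop) : P ord0 -> P ord_max -> forall i, P i.
Proof.
move=> P0 P1 [[|[|i]] hi] //; first by rewrite (_ : Ordinal hi = ord0)//; exact/val_inj.
by rewrite (_ : Ordinal hi = ord_max)//; exact/val_inj.
Qed.

Lemma sum_ord2 (V : nmodType) (f : 'I_2 -> V) : \sum_i f i = f ord0 + f ord_max.
Proof. by rewrite !big_ord_recl big_ord0 addr0; congr (_ + f _); exact/val_inj. Qed.

Lemma col2E (x : 'cV[R]_2) : x = col2 (x ord0 ord0) (x ord_max ord0).
Proof. by apply/colP; apply: ord2P; rewrite !mxE. Qed.

Lemma mx22_col2 a b c d x y : mx22 a b c d *m col2 x y = col2 (a * x + b * y) (c * x + d * y).
Proof. by apply/colP; apply: ord2P; rewrite !mxE sum_ord2 !mxE. Qed.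

Lemma mx22M a b c d a' b' c' d' : mx22 a b c d *m mx22 a' b' c' d' =
  mx22 (a * a' + b * c') (a * b' + b * d') (c * a' + d * c') (c * b' + d * d').
Proof. by apply/matrixP => i j; move: i; apply: ord2P; move: j; apply: ord2P; rewrite !mxE sum_ord2 !mxE. Qed.

Lemma mx22N a b c d : - mx22 a b c d = mx22 (- a) (- b) (- c) (- d).
Proof. by apply/matrixP => i j; move: i; apply: ord2P; move: j; apply: ord2P; rewrite !mxE. Qed.

Lemma mx22D a b c d a' b' c' d' : mx22 a b c d + mx22 a' b' c' d' = mx22 (a + a') (b + b') (c + c') (d + d').
Proof. by apply/matrixP => i j; move: i; apply: ord2P; move: j; apply: ord2P; rewrite !mxE. Qed.

Lemma mx22_scalar a : a%:M = mx22 a 0 0 a.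
Proof. by apply/matrixP => i j; move: i; apply: ord2P; move: j; apply: ord2P; rewrite !mxE. Qed.

Lemma mx22_inj a b c d a' b' c' d' : a = a' -> b = b' -> c = c' -> d = d' ->
  mx22 a b c d = mx22 a' b' c' d'.
Proof. by move=> -> -> -> ->. Qed.

Lemma enormE (x : 'cV[R]_2) : enorm x = Num.sqrt (x ord0 ord0 ^+ 2 + x ord_max ord0 ^+ 2).
Proof. by rewrite /enorm sum_ord2. Qed.

Lemma coord_le_enorm (x : 'cV[R]_2) i : `|x i ord0| <= enorm x.
Proof.
rewrite enormE -sqrtr_sqr ler_wsqrtr//; move: i.
by apply: ord2P; rewrite ?lerDl ?lerDr sqr_ge0.
Qed.

Lemma enorm_le (x : 'cV[R]_2) : enorm x <= `|x ord0 ord0| + `|x ord_max ord0|.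
Proof.
rewrite enormE -[leRHS]ger0_norm ?addr_ge0// -sqrtr_sqr ler_wsqrtr//.
rewrite sqrrD !real_normK ?num_real//.
have : 0 <= `|x ord0 ord0| * `|x ord_max ord0| by rewrite mulr_ge0.
rewrite -mulr_natl; lra.
Qed.

Variable q : R.
Hypotheses (q0 : 0 < q) (q1 : q < 1) (qE : q ^+ 4 - 2 * q ^+ 3 - 2 * q + 1 = 0).
Local Notation c := (q * (1 - q)).

(* In the coordinates [coord_a], [coord_b] below, this is (a, b) |-> (b, - a). *)
Definition quarter_turn : 'M[R]_2 :=
  mx22 ((q ^+ 3 + 1) / c) (- (q ^+ 4 + 1) / c) ((q ^+ 2 + 1) / c) (- (q ^+ 3 + 1) / c).
Definition node (eta : R) : 'M[R]_2 := mx22 (- (2 + eta)) 0 0 (- (1 + eta)).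
(** The conjugate of [node eta] by [J], because J^-1 = - J. *)
Definition turned_node (eta : R) : 'M[R]_2 := - (quarter_turn *m node eta *m quarter_turn).
Local Notation J := quarter_turn.

Let c0 : c != 0. Proof. by rewrite mulf_neq0 ?gt_eqF// subr_gt0. Qed.
Let q00 : q != 0. Proof. by rewrite gt_eqF. Qed.
Let q10 : 1 - q != 0. Proof. by rewrite gt_eqF// subr_gt0. Qed.

Lemma quarter_turnK : J *m J = - 1%:M.
Proof.
by rewrite mx22M mx22_scalar mx22N; apply: mx22_inj; field; rewrite q00 q10.
Qed.

Lemma quarter_turn_diag x : J *m col2 x x = col2 (q ^+ 2 * x) (q * x).
Proof. by rewrite mx22_col2; congr col2; field; rewrite q00 q10. Qed.

Lemma turned_nodeE eta : turned_node eta =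
  mx22 (((q ^+ 3 + 1) / c) ^+ 2 - 1 - eta) (- ((q ^+ 3 + 1) * (q ^+ 4 + 1)) / c ^+ 2)
       ((q ^+ 3 + 1) * (q ^+ 2 + 1) / c ^+ 2) (- ((q ^+ 4 + 1) * (q ^+ 2 + 1)) / c ^+ 2 - 1 - eta).
Proof.
by rewrite /turned_node !mx22M mx22N; apply: mx22_inj; field; rewrite q00 q10.
Qed.

(** [coord_a] and [coord_b] are the coordinates in the basis formed of J (1, 1) = (q^2, q) and (1,
    1), the endpoints of the first arc. *)
Definition coord_a (x : 'cV[R]_2) : R := c^-1 * (x ord_max ord0 - x ord0 ord0).
Definition coord_b (x : 'cV[R]_2) : R := (1 - q)^-1 * (x ord0 ord0 - q * x ord_max ord0).
Definition spiral_norm (x : 'cV[R]_2) : R := spiral R q (coord_a x) (coord_b x).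

Lemma coordE0 (x : 'cV[R]_2) : x ord0 ord0 = q ^+ 2 * coord_a x + coord_b x.
Proof. by rewrite /coord_a /coord_b; field; rewrite q00 q10. Qed.

Lemma coordE1 (x : 'cV[R]_2) : x ord_max ord0 = q * coord_a x + coord_b x.
Proof. by rewrite /coord_a /coord_b; field; rewrite q00 q10. Qed.

Lemma switched_flow_coord (eta u : R) (x : R -> 'cV[R]_2) (t : R) :
    is_derive t (1 : R) x (u *: (node eta *m x t) + (1 - u) *: (turned_node eta *m x t)) ->
  switched_flow R q eta u (coord_a \o x) (coord_b \o x) t.
Proof.
move=> /is_derive_coord h; move: {h}(h ord0) (h ord_max).
set y0 := x t ord0 ord0; set y1 := x t ord_max ord0.
rewrite turned_nodeE (col2E (x t)) !mx22_col2 !mxE /= -/y0 -/y1 => h0 h1.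
split.
  apply: is_derive_eq (is_deriveZ (c^-1) (is_deriveB h1 h0)) _.
  by rewrite /= /coord_a /coord_b /GRing.scale /= -/y0 -/y1; field; rewrite q00 q10.
apply: is_derive_eq (is_deriveZ ((1 - q)^-1) (is_deriveB h0 (is_deriveZ q h1))) _.
by rewrite /= /coord_a /coord_b /GRing.scale /= -/y0 -/y1; field; rewrite q00 q10.
Qed.

(** A bound [m] on the entries replaces a norm, in order to serve both the sup norm and [enorm]. *)
Lemma coord_norm_le (x : 'cV[R]_2) (m : R) : (forall i, `|x i ord0| <= m) ->
  `|coord_a x| + `|coord_b x| <= 4 / c * m.
Proof.
move=> xm; have x0 := xm ord0; have x1 := xm ord_max.
have cp : 0 < c by rewrite mulr_gt0// subr_gt0.
have ha : `|coord_a x| <= 2 / c * m.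
  rewrite normrM normfV (gtr0_norm cp) mulrAC [leRHS]mulrC ler_pM2l ?invr_gt0//.
  by apply: le_trans (ler_normB _ _) _; lra.
have hb : `|coord_b x| <= 2 / c * m.
  apply: (@le_trans _ _ ((1 - q)^-1 * (2 * m))).
    rewrite normrM normfV (gtr0_norm (_ : 0 < 1 - q)) ?subr_gt0//.
    rewrite ler_wpM2l// ?invr_ge0 ?subr_ge0 ?(ltW q1)//.
    apply: le_trans (ler_normB _ _) _; rewrite normrM (gtr0_norm q0).
    have : q * `|x ord_max ord0| <= `|x ord_max ord0| by rewrite ler_piMl// ltW.
    lra.
  have m0 : 0 <= m by apply: le_trans x0.
  rewrite mulrCA -mulrA ler_wpM2l// ler_wpM2r// lef_pV2 ?posrE ?subr_gt0//.
  by rewrite ler_piMl ?subr_ge0 ?ltW.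
have -> : 4 / c * m = 2 / c * m + 2 / c * m by lra.
exact: lerD.
Qed.

Lemma spiral_norm_lipschitz (x y : 'cV[R]_2) :
  `|spiral_norm x - spiral_norm y| <= (12 / q ^+ 2 + 1) * (4 / c) * `|x - y|.
Proof.
apply: le_trans (spiral_lipschitz R q q0 q1 _ _ _ _) _; rewrite -mulrA ler_wpM2l//.
  by rewrite addr_ge0// divr_ge0// exprn_ge0// ltW.
have -> : coord_a x - coord_a y = coord_a (x - y) by rewrite /coord_a !mxE; ring.
have -> : coord_b x - coord_b y = coord_b (x - y) by rewrite /coord_b !mxE; ring.
by apply: coord_norm_le => i; exact: coord_le_norm.
Qed.

(** [spiral_norm] decays at rate eta / 2 along every solution. It is comparable to [enorm] by
    [spiral_ge] and [spiral_le], and the two comparison constants multiply to the constant M. *)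
Lemma GUES_node (U : set R) (eta : R) : (forall u, U u -> 0 <= u <= 1) -> 0 < eta ->
  GUES U (node eta) (turned_node eta).
Proof.
move=> U01 eta0; have cp : 0 < c by rewrite mulr_gt0// subr_gt0.
pose L : R := 12 / q ^+ 2 + 1.
have L0 : 0 < L by rewrite ltr_wpDl// divr_ge0// exprn_ge0// ltW.
have q20 : 0 < q ^+ 2 by rewrite exprn_gt0.
exists (2 / q ^+ 2 * (L * (4 / c))), (eta / 2); split; first by rewrite !mulr_gt0 ?invr_gt0.
split=> [|u x [_ uU] [acx aex] t t0]; first by rewrite divr_gt0.
have decay : spiral_norm (x t) <= expR (- (eta / 2) * t) * spiral_norm (x 0).
  apply: (slope_le_exp_decay R (spiral_norm \o x) eta eta0) t0.
  - move=> s; apply: le_trans (spiral_ge R q q0 q1 _ _).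
    by rewrite mulr_ge0 ?addr_ge0// ltW.
  - by move=> T T0; exact: abs_continuous_comp spiral_norm_lipschitz (acx T T0).
  - apply: lebesgue_ae_impl aex => s hs s0.
    exact: (switched_flow_spiral R q q0 q1 qE eta (u s) (coord_a \o x) (coord_b \o x) s
      (U01 _ (uU _ (ltW s0))) (switched_flow_coord _ _ _ _ (hs s0))).
have lower : enorm (x t) <= 2 / q ^+ 2 * spiral_norm (x t).
  have sg := spiral_ge R q q0 q1 (coord_a (x t)) (coord_b (x t)).
  rewrite -ler_pdivrMl ?divr_gt0// invf_div; apply: le_trans sg.
  rewrite mulrAC -mulrA ler_wpM2l ?(ltW q20)// ler_pdivrMr//.
  apply: le_trans (enorm_le _) _; rewrite coordE0 coordE1.
  have bnd (v a b : R) : 0 <= v <= 1 -> `|v * a + b| <= `|a| + `|b|.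
    move=> /andP[v0 v1]; apply: le_trans (ler_normD _ _) _.
    by rewrite lerD2r normrM (ger0_norm v0) ler_piMl.
  have b1 : 0 <= q ^+ 2 <= 1 by rewrite ltW//= exprn_ile1// ltW.
  have b2 : 0 <= q <= 1 by rewrite !ltW.
  by have := bnd _ (coord_a (x t)) (coord_b (x t)) b1;
     have := bnd _ (coord_a (x t)) (coord_b (x t)) b2; lra.
have upper : spiral_norm (x 0) <= L * (4 / c) * enorm (x 0).
  apply: le_trans (spiral_le R q q0 q1 _ _) _; rewrite -mulrA ler_wpM2l ?(ltW L0)//.
  by apply: coord_norm_le => i; exact: coord_le_enorm.
apply: le_trans lower _.
have -> : 2 / q ^+ 2 * (L * (4 / c)) * expR (- (eta / 2) * t) * enorm (x 0) =
  2 / q ^+ 2 * (expR (- (eta / 2) * t) * (L * (4 / c) * enorm (x 0))) by ring.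
rewrite ler_wpM2l ?divr_ge0 ?(ltW q20)//; apply: le_trans decay _.
by rewrite ler_wpM2l ?expR_ge0.
Qed.

Lemma quarter_turn_node eta : turned_node eta *m J = J *m node eta.
Proof. by rewrite /turned_node mulNmx -(mulmxA (J *m node eta) J J) quarter_turnK mulmxN mulmx1 opprK. Qed.

(** An eigenvalue is a root of every polynomial that annihilates the matrix, so it can only be - n
    or - m. *)
Lemma hurwitz_quadratic (n m : R) (M : 'M[R]_2) : 0 < n -> 0 < m ->
  (M + n%:M) *m (M + m%:M) = 0 -> hurwitz M.
Proof.
move=> n0 m0 hM z /eigenvalueP[v vM v0].
pose f (N : 'M[R]_2) := map_mx (real_complex R) N.
have hM' : (f M + (n%:C)%C%:M) *m (f M + (m%:C)%C%:M) = 0.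
  by rewrite -!map_scalar_mx -!map_mxD -map_mxM hM map_mx0.
have : v *m ((f M + (n%:C)%C%:M) *m (f M + (m%:C)%C%:M)) = 0 by rewrite hM' mulmx0.
have {}vM : v *m f M = z *: v by [].
rewrite mulmxA (mulmxDr v) vM mul_mx_scalar -scalerDl -scalemxAl (mulmxDr v) vM mul_mx_scalar -scalerDl scalerA.
move/eqP; rewrite scaler_eq0 (negPf v0) orbF mulf_eq0 !addr_eq0.
by move=> /orP[] /eqP ->; rewrite /= oppr_lt0.
Qed.

Lemma node_quadratic eta : (node eta + (2 + eta)%:M) *m (node eta + (1 + eta)%:M) = 0.
Proof.
rewrite !mx22_scalar !mx22D mx22M.
by apply/matrixP => i j; move: i; apply: ord2P; move: j; apply: ord2P; rewrite !mxE /=; ring.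
Qed.

Lemma hurwitz_node eta : 0 < eta -> hurwitz (node eta).
Proof.
move=> eta0; apply: (hurwitz_quadratic (2 + eta) (1 + eta)); rewrite ?addr_gt0//.
exact: node_quadratic.
Qed.

Lemma hurwitz_turned_node eta : 0 < eta -> hurwitz (turned_node eta).
Proof.
move=> eta0; apply: (hurwitz_quadratic (2 + eta) (1 + eta)); rewrite ?addr_gt0//.
(* As J^2 = - 1, conjugation respects the addition of scalars, so the quadratic relation passes from
   [node] to [turned_node]. *)
have Jn n : turned_node eta + n%:M = - (J *m (node eta + n%:M) *m J).
  rewrite mulmxDr mulmxDl opprD; congr (_ + _).
  by rewrite mul_mx_scalar -scalemxAl quarter_turnK scalerN opprK scalemx1.
rewrite !Jn mulNmx mulmxN opprK -!mulmxA [J *m (J *m _)]mulmxA quarter_turnK.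
rewrite mulNmx mul1mx mulmxN [(_ + _) *m (_ *m _)]mulmxA.
by rewrite node_quadratic mul0mx oppr0 mulmx0.
Qed.
End plane.

(** * Trajectories with constant input *)

Section trajectories.
Variables (R : realType) (q : R).
Hypotheses (q0 : 0 < q) (q1 : q < 1).
Local Notation J := (quarter_turn R q).
Local Notation node := (node R).
Local Notation col2 := (col2 R).

Definition node_flow (eta : R) (v : 'cV[R]_2) (t : R) : 'cV[R]_2 :=
  col2 (expR (- (2 + eta) * t) * v ord0 ord0) (expR (- (1 + eta) * t) * v ord_max ord0).

Lemma is_derive_expRM (k t : R) : is_derive t (1 : R) (fun s => expR (k * s)) (k * expR (k * t)).
Proof.
have h1 : is_derive t (1 : R) (fun s => k * s) k.
  by apply: is_derive_eq (is_deriveZ k (is_derive_id t (1 : R))) _; rewrite /GRing.scale /= mulr1.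
have h2 := @is_derive1_comp R (@expR R) (fun s => k * s) t _ _ (is_derive_expR (k * t)) h1.
by rewrite mulrC; exact: h2.
Qed.

Lemma expR_decay_lipschitz (k s t : R) : 0 <= k -> 0 <= s -> s <= t ->
  `|expR (- k * t) - expR (- k * s)| <= k * (t - s).
Proof.
move=> k0 s0 st; have ks : 0 <= k * (t - s) by rewrite mulr_ge0// subr_ge0.
have -> : - k * t = - k * s - k * (t - s) by ring.
rewrite expRD -[X in _ - X]mulr1 -mulrBr normrM ger0_norm ?expR_ge0//.
have e1 : expR (- (k * (t - s))) <= 1 by rewrite -expR0 ler_expR oppr_le0.
rewrite ler0_norm ?subr_le0// opprB.
have := expR_ge1Dx (- (k * (t - s))) => e2.
apply: (@le_trans _ _ (1 * (1 - expR (- (k * (t - s)))))); last lra.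
rewrite ler_wpM2r ?subr_ge0// -expR0 ler_expR mulNr oppr_le0 mulr_ge0//.
Qed.

Lemma abs_continuous_lipschitz (W : normedModType R) (a b L : R) (f : R -> W) :
  (forall s t, a <= s -> s <= t -> t <= b -> `|f t - f s| <= L * (t - s)) -> abs_continuous a b f.
Proof.
move=> fL e e0; pose K := Num.max L 1; have K0 : 0 < K by rewrite lt_max ltr01 orbT.
exists (e / K); first exact: divr_gt0.
move=> n s t hst _ len; apply: (@le_lt_trans _ _ (K * \sum_i (t i - s i))).
  rewrite mulr_sumr; apply: ler_sum => i _; have [as_ [st tb]] := hst i.
  apply: le_trans (fL _ _ as_ st tb) _.
  by rewrite ler_wpM2r ?subr_ge0// le_max lexx.
by rewrite mulrC -ltr_pdivlMr.
Qed.

(** [M] is the vector field selected by the input and [K] conjugates it to [node eta]: with [K] the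
    identity or [J], one computation serves both fields. *)
Lemma solution_node_flow (A B M K : 'M[R]_2) (u : R -> R) (eta : R) (v : 'cV[R]_2) : 0 < eta ->
    (forall t (y : 'cV[R]_2), u t *: (A *m y) + (1 - u t) *: (B *m y) = M *m y) ->
    M *m K = K *m node eta ->
  solution A B u (fun t => K *m node_flow eta v t).
Proof.
move=> eta0 uM MK; split=> [T _|].
  have entry i t : (K *m node_flow eta v t) i ord0 =
      K i ord0 * (expR (- (2 + eta) * t) * v ord0 ord0) +
      K i ord_max * (expR (- (1 + eta) * t) * v ord_max ord0).
    by rewrite mxE sum_ord2 !mxE.
  pose C i := `|K i ord0| * `|v ord0 ord0| * (2 + eta) + `|K i ord_max| * `|v ord_max ord0| * (1 + eta).
  have C0 i : 0 <= C i by rewrite addr_ge0// !mulr_ge0// addr_ge0// ltW.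
  apply: (@abs_continuous_lipschitz _ _ _ (C ord0 + C ord_max)) => s t s0 st _.
  rewrite [leLHS]/Num.norm /= mx_normrE; apply/bigmax_leP; split=> [|[i j] _ /=].
    by apply: mulr_ge0; [exact: addr_ge0|rewrite subr_ge0].
  rewrite (ord1 j); have subE (x y : 'cV[R]_2) : (x - y) i ord0 = x i ord0 - y i ord0 by rewrite !mxE.
  rewrite subE !entry.
  apply: (@le_trans _ _ (C i * (t - s))); last first.
    rewrite ler_wpM2r ?subr_ge0//; clear subE; move: i; apply: ord2P; rewrite ?lerDl ?lerDr//.
  have -> : K i ord0 * (expR (- (2 + eta) * t) * v ord0 ord0) + K i ord_max * (expR (- (1 + eta) * t) * v ord_max ord0) -
     (K i ord0 * (expR (- (2 + eta) * s) * v ord0 ord0) + K i ord_max * (expR (- (1 + eta) * s) * v ord_max ord0)) =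
     K i ord0 * v ord0 ord0 * (expR (- (2 + eta) * t) - expR (- (2 + eta) * s)) +
     K i ord_max * v ord_max ord0 * (expR (- (1 + eta) * t) - expR (- (1 + eta) * s)) by ring.
  apply: le_trans (ler_normD _ _) _; rewrite !normrM mulrDl -!(mulrA _ _ (t - s)).
  by apply: lerD; rewrite ler_wpM2l ?mulr_ge0// expR_decay_lipschitz// addr_ge0// ltW.
exists set0; split => // t /= nd; exfalso; apply: nd => t0.
rewrite uM mulmxA MK -mulmxA; apply/is_derive_coord => i.
rewrite (_ : (fun s => _) = (fun s => K i ord0 * v ord0 ord0 * expR (- (2 + eta) * s) +
   K i ord_max * v ord_max ord0 * expR (- (1 + eta) * s))); last first.
  by apply/funext => s; rewrite mxE sum_ord2 !mxE /=; ring.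
apply: is_derive_eq (is_deriveD (is_deriveZ _ (is_derive_expRM _ _)) (is_deriveZ _ (is_derive_expRM _ _))) _.
by rewrite /node_flow /node mx22_col2 mxE sum_ord2 !mxE /GRing.scale /=; ring.
Qed.

(** A common Lyapunov function is only required to decrease along nonconstant trajectories. Here
    both exponentials decay strictly, so equal values at times 0 and 1 force v = 0. *)
Lemma node_flow_nonconstant (K : 'M[R]_2) (eta : R) (v : 'cV[R]_2) : 0 < eta ->
    (forall y z : 'cV[R]_2, K *m y = K *m z -> y = z) -> v != 0 ->
  nonconstant (fun t => K *m node_flow eta v t).
Proof.
move=> eta0 Kinj /eqP v0 [c xc]; apply: v0.
have /Kinj e01 : K *m node_flow eta v 1 = K *m node_flow eta v 0 by rewrite !xc.
have killed (k y : R) : 0 < k -> expR (- k * 1) * y = expR (- k * 0) * y -> y = 0.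
  rewrite mulr0 expR0 mul1r mulr1 => k0 /eqP; rewrite -subr_eq0 -[X in _ - X]mul1r -mulrBl mulf_eq0.
  move=> /orP[|/eqP//]; rewrite subr_eq0 -expR0 => /eqP/expR_inj; lra.
apply/colP; apply: ord2P; rewrite mxE.
  by apply: (killed (2 + eta)); [rewrite addr_gt0|have := congr1 (fun y : 'cV[R]_2 => y ord0 ord0) e01; rewrite !mxE].
by apply: (killed (1 + eta)); [rewrite addr_gt0|have := congr1 (fun y : 'cV[R]_2 => y ord_max ord0) e01; rewrite !mxE].
Qed.


Lemma CLF_node_flow (U : set R) (A B M K : 'M[R]_2) (w eta : R) (V : 'cV[R]_2 -> R) (v : 'cV[R]_2) :
    CLF U A B V -> U w -> w *: A + (1 - w) *: B = M -> M *m K = K *m node eta -> 0 < eta ->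
    (forall y z : 'cV[R]_2, K *m y = K *m z -> y = z) -> v != 0 ->
  forall s t, 0 <= s -> s < t -> V (K *m node_flow eta v t) < V (K *m node_flow eta v s).
Proof.
move=> [_ _ _ dec] Uw wM MK eta0 Kinj v0 s t s0 st.
apply: (dec (cst w) (fun t => K *m node_flow eta v t)) => //.
- apply: solution_node_flow (MK) => // r y.
  by rewrite -wM mulmxDl !scalemxAl.
- exact: node_flow_nonconstant.
Qed.

Lemma node_flow0 eta v : node_flow eta v 0 = v.
Proof. by rewrite /node_flow !mulr0 expR0 !mul1r -col2E. Qed.

(** [tau] is the duration of an arc: e^(- 2 tau) = q^2 and e^(- tau) = q lead from (1, 1) to J (1,
    1), and [eta] only adds a scalar factor. *)
Lemma node_flow_diag (eta tau x : R) : q = expR (- tau) ->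
  node_flow eta (col2 x x) tau = J *m col2 (expR (- (eta * tau)) * x) (expR (- (eta * tau)) * x).
Proof.
move=> qtau; rewrite quarter_turn_diag// qtau /node_flow !mxE /= -expRM_natl !mulrA -!expRD.
by congr col2; congr (expR _ * _); ring.
Qed.

(** Four arcs, with inputs 1, 0, 1, 0, make a full turn and bring s (1, 1) back to the same ray. [V]
    decreases all along, so its values on the first arc lie between those at the two ends of the
    turn. *)
Lemma CLF_node_turn (U : set R) (eta tau : R) (V : 'cV[R]_2 -> R) : U 0 -> U 1 -> 0 < eta ->
    q = expR (- tau) -> CLF U (node eta) (turned_node R q eta) V ->
  forall s t, 0 < s -> 0 <= t <= tau ->
    V (col2 (expR (- (eta * tau)) ^+ 4 * s) (expR (- (eta * tau)) ^+ 4 * s)) <= V (node_flow eta (col2 s s) t)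
      <= V (col2 s s).
Proof.
move=> U0 U1 eta0 qtau clf s t s0 /andP[t0 ttau].
set r := expR (- (eta * tau)).
have r0 : r != 0 by rewrite gt_eqF// expR_gt0.
have tau0 : 0 < tau by move: q1; rewrite qtau -[X in _ < X]expR0 ltr_expR oppr_lt0.
have diag0 x : x != 0 -> col2 x x != 0.
  by apply: contra_neq => /(congr1 (fun y : 'cV[R]_2 => y ord0 ord0)); rewrite !mxE.
have JJ (y : 'cV[R]_2) : J *m (J *m y) = - y by rewrite mulmxA quarter_turnK// mulNmx mul1mx.
have Jinj (y z : 'cV[R]_2) : J *m y = J *m z -> y = z.
  by move=> /(congr1 (fun y => J *m y)); rewrite !JJ => /oppr_inj.
have stepA x s' t' : x != 0 -> 0 <= s' -> s' < t' -> V (node_flow eta (col2 x x) t') < V (node_flow eta (col2 x x) s').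
  move=> x0; have := CLF_node_flow _ _ _ (node eta) 1%:M 1 eta V (col2 x x) clf U1 _ _ eta0 _ (diag0 x x0) s' t'.
  rewrite !mul1mx; apply => [||y z]; last by rewrite !mul1mx.
    by rewrite subrr scale1r scale0r addr0.
  by rewrite mulmx1.
have stepB x : x != 0 -> V (col2 (- (r * x)) (- (r * x))) < V (J *m col2 x x).
  move=> x0; have := CLF_node_flow _ _ _ (turned_node R q eta) J 0 eta V (col2 x x) clf U0 _ _ eta0 Jinj (diag0 x x0) 0 tau.
  rewrite node_flow0 (node_flow_diag eta tau x qtau) JJ.
  rewrite (_ : - col2 _ _ = col2 (- (r * x)) (- (r * x))); first apply => //.
  - by rewrite scale0r add0r subr0 scale1r.
  - exact: quarter_turn_node.
  - by apply/colP; apply: ord2P; rewrite !mxE.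
have stepA' x : x != 0 -> V (J *m col2 (r * x) (r * x)) < V (col2 x x).
  by move=> x0; rewrite -(node_flow_diag eta tau x qtau) -[X in _ < V X](node_flow0 eta); exact: stepA.
have s00 : s != 0 by rewrite gt_eqF.
apply/andP; split; last first.
  move: t0; rewrite le_eqVlt => /orP[/eqP <-|t0]; first by rewrite node_flow0.
  by rewrite -[X in _ <= V X](node_flow0 eta) ltW// stepA.
(* The three remaining arcs, taken in order of time: [stepB], [stepA'], [stepB]. *)
apply: (@le_trans _ _ (V (node_flow eta (col2 s s) tau))).
  rewrite (node_flow_diag eta tau s qtau) -/r ltW//.
  apply: lt_trans (stepB _ (mulf_neq0 r0 s00)).
  have n1 : - (r * (r * s)) != 0 by rewrite oppr_eq0 !mulf_neq0.
  apply: lt_trans (stepA' _ n1).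
  have n2 : r * - (r * (r * s)) != 0 by rewrite mulf_neq0.
  have := stepB _ n2; congr (V (col2 _ _) < _); ring.
move: ttau; rewrite le_eqVlt => /orP[/eqP -> //|ttau].
by rewrite ltW// stepA.
Qed.

End trajectories.

(** * Piecewise polynomial functions along an arc *)

(** Pigeonhole: cut the steps into m + 1 blocks of [N]. If each block left the sector of its
    starting point, two blocks would start in the same sector, but a nondecreasing angle that stays
    in [0, pi[ cannot come back to a sector after leaving it. *)
Lemma common_sector (R : realType) (n m N : nat) (al be : 'I_n -> R) (phi : nat -> R) :
    (n <= m)%N -> (forall i j, (i <= j)%N -> phi i <= phi j) -> (forall k, 0 <= phi k < pi) ->
    (forall k, exists j th, [/\ al j <= th, th < be j, cos th = cos (phi k) & sin th = sin (phi k)]) ->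
  exists j k0, (k0 + N <= m.+1 * N)%N /\ forall i, (i <= N)%N ->
    exists th, [/\ al j <= th, th < be j, cos th = cos (phi (k0 + i)%N) & sin th = sin (phi (k0 + i)%N)].
Proof.
move=> nm phi_le phi_pi phi_cone.
have /choice[f fP] : forall b : 'I_m.+1, exists jt : 'I_n * R, [/\ al jt.1 <= jt.2, jt.2 < be jt.1,
    cos jt.2 = cos (phi (b * N)%N) & sin jt.2 = sin (phi (b * N)%N)].
  by move=> b; have [j [th h]] := phi_cone (b * N)%N; exists (j, th).
have [[b fb]|nfb] := pselect (exists b : 'I_m.+1,
    (f b).2 + (phi (b * N + N)%N - phi (b * N)%N) < be (f b).1).
  exists (f b).1, (b * N)%N; split; first by rewrite addnC -mulSn leq_mul2r ltn_ord orbT.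
  move=> i iN; have [h1 h2 h3 h4] := fP b.
  have l1 := phi_le _ _ (leq_addr i (b * N)%N).
  have l2 : phi (b * N + i)%N <= phi (b * N + N)%N by apply: phi_le; rewrite leq_add2l.
  exists ((f b).2 + (phi (b * N + i)%N - phi (b * N)%N)); split; [lra|lra| |].
    by rewrite cosD h3 h4 -cosD; congr cos; ring.
  by rewrite sinD h3 h4 -sinD; congr sin; ring.
have exit b : be (f b).1 <= (f b).2 + (phi (b * N + N)%N - phi (b * N)%N).
  by rewrite leNgt; apply/negP => fb; apply: nfb; exists b.
have [b [b' [bb' jb]]] : exists b b' : 'I_m.+1, (b < b')%N /\ (f b).1 = (f b').1.
  apply: contrapT => nex.
  have inj : injective (fun b => (f b).1).
    move=> b b' jb; apply: val_inj; case: (ltngtP b b') => // lt; exfalso; apply: nex.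
      by exists b, b'.
    by exists b', b.
  by have := leq_card _ inj; rewrite !card_ord ltnNge nm.
have [h1 h2 h3 h4] := fP b; have [h1' h2' h3' h4'] := fP b'.
have e1 := exit b; have e2 := exit b'; rewrite -jb in h2' e2.
have lt1 : phi (b * N + N)%N <= phi (b' * N)%N.
  by apply: phi_le; rewrite addnC -mulSn leq_mul2r bb' orbT.
have lt2 := phi_le _ _ (leq_addr N (b' * N)%N).
have /andP[_ lt3] := phi_pi (b' * N + N)%N; have /andP[lt4 _] := phi_pi (b * N)%N.
(* The exit inequalities place this difference of angle increments in ]0, pi[, whereas equal sines
   and cosines make its sine vanish. *)
have : 0 < sin ((phi (b' * N)%N - phi (b * N)%N) - ((f b').2 - (f b).2)).
  apply: sin_gt0_pi; lra.
rewrite sinB sinB cosB sinB cosB h3 h4 h3' h4'.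
set c := cos _; set s := sin _; set c' := cos _; set s' := sin _.
rewrite (_ : _ - _ = 0) ?ltxx//; ring.
Qed.

Lemma meval_bmultinom (R : realType) (k : nat) (p : mpoly.mpoly 2 R) (v : 'I_2 -> R) :
    (msize p <= k)%N ->
  meval v p = \sum_(m : bmultinom 2 k) mcoeff m p * (v ord0 ^+ m ord0 * v ord_max ^+ m ord_max).
Proof.
move=> pk; rewrite {1}(mpolywE pk) raddf_sum /=; apply: eq_bigr => m _.
rewrite mevalZ mevalX !big_ord_recl big_ord0 mulr1.
by rewrite (_ : lift _ _ = ord_max); last exact: val_inj.
Qed.

Lemma meval_at0 (R : realType) (n : nat) (p : mpoly.mpoly n R) :
  meval (fun=> 0) p = mcoeff (@mnm0 n) p.
Proof.
rewrite {2}[p]mpolyE [RHS]raddf_sum mevalE /=; apply: eq_bigr => m _.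
rewrite mcoeffZ mcoeffX; congr (_ * _); have [->|m0] := eqVneq m (@mnm0 n).
  by apply: big1 => i _; rewrite mnm0E expr0.
have [i mi] : exists i, m i != 0%N.
  apply: contrapT => nex; move/eqP: m0; apply; apply/mnmP => i; rewrite mnm0E.
  by apply/eqP; apply: contrapT => /negP mi; apply: nex; exists i.
by rewrite (bigD1 i)//= expr0n (negPf mi) mul0r.
Qed.

Lemma meval_ray (R : realType) (k : nat) (p : mpoly.mpoly 2 R) : (msize p <= k)%N ->
  exists2 g : {poly R}, (size g <= k)%N & forall x, meval (fun=> x) p = g.[x].
Proof.
move=> pk; exists (\sum_(m : bmultinom 2 k) mcoeff m p *: 'X^(m ord0 + m ord_max)%N).
  apply: leq_trans (size_sum _ _ _) _; apply/bigmax_leqP => -[m mk] _.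
  apply: leq_trans (size_scale_leq _ _) _; rewrite size_polyXn /=.
  by move: mk; rewrite mdegE sum_ord2.
move=> x; rewrite (meval_bmultinom _ _ _ _ pk) horner_sum; apply: eq_bigr => m _.
by rewrite hornerZ hornerXn exprD.
Qed.

Lemma polar_atan (R : realType) (x y : R) : 0 < x ->
  col2 R x y = polar (x * Num.sqrt (1 + (y / x) ^+ 2)) (atan (y / x)).
Proof.
move=> x0; have s0 : Num.sqrt (1 + (y / x) ^+ 2) != 0.
  by rewrite gt_eqF// sqrtr_gt0 ltr_wpDr ?sqr_ge0.
have c0 : cos (atan (y / x)) = (Num.sqrt (1 + (y / x) ^+ 2))^-1 by exact: cos_atan.
have sE : sin (atan (y / x)) = y / x * cos (atan (y / x)).
  by rewrite -[X in _ = X * _](atanK (y / x)) /tan divfK// c0 invr_eq0.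
apply/colP; apply: ord2P; rewrite !mxE /= ?sE c0.
  by rewrite mulfK.
move: s0; set S := Num.sqrt _ => s0; by field; rewrite s0 gt_eqF.
Qed.

Lemma polar_eq (R : realType) (r r' th th' : R) : 0 < r -> 0 <= r' ->
  polar r th = polar r' th' -> r = r' /\ cos th = cos th' /\ sin th = sin th'.
Proof.
move=> r0 r'0 e; have := congr1 (fun y : 'cV[R]_2 => y ord0 ord0) e.
have := congr1 (fun y : 'cV[R]_2 => y ord_max ord0) e; rewrite !mxE /= => es ec.
have rr : r = r'.
  apply/eqP; rewrite -(@eqrXn2 _ 2) ?(ltW r0)//; apply/eqP.
  rewrite -[LHS]mulr1 -[RHS]mulr1 -{1}(cos2Dsin2 th) -(cos2Dsin2 th') !mulrDr -!exprMn.
  by rewrite es ec.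
subst r'; split=> //; have rn : r != 0 by rewrite gt_eqF.
by split; apply: (mulfI rn).
Qed.

Section piecewise.
Variables (R : realType) (m : nat) (W : ppf R).
Hypothesis Wm : (total_degree W <= m)%N.

Lemma ncones_le : (ppf_ncones W <= m)%N.
Proof. by apply: leq_trans Wm; rewrite /total_degree leq_maxl. Qed.

Lemma msize_ppf_poly (j : 'I_(ppf_ncones W)) : (msize (ppf_poly j) <= m.+1)%N.
Proof.
have : ((msize (ppf_poly j)).-1 <= m)%N.
  apply: leq_trans Wm; rewrite /total_degree leq_max; apply/orP; right.
  exact: (@leq_bigmax _ (fun j => (msize (ppf_poly j)).-1)).
by case: (msize _).
Qed.

(** The apex belongs to every cone, so every piece vanishes at the origin: this is why no piece has
    a constant term. *)
Lemma ppf_poly_at0 (j : 'I_(ppf_ncones W)) : W 0 = 0 -> mcoeff (@mnm0 2) (ppf_poly j) = 0.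
Proof.
move=> W0; rewrite -meval_at0 -[RHS]W0 (@ppf_polyE _ W j).
  by apply: meval_eq => i; rewrite mxE.
exists 0, (ppf_angles j).1; split=> //; first exact: ppf_angles_lt.
by apply/colP => i; rewrite !mxE; case: ifP; rewrite mul0r.
Qed.

(** The diagonal ray lies in a single cone, so [W] restricts there to a polynomial in one variable
    of degree at most [m], to which [polynomial_small_scale] applies. *)
Lemma ppf_ray (r : R) : 0 < r < 1 -> W 0 = 0 -> (forall x, x != 0 -> 0 < W x) ->
  exists2 s, 0 < s & r ^+ m.+1 * W (col2 R s s) <= W (col2 R (r * s) (r * s)).
Proof.
move=> r01 W0 Wpos; have [j [rho [th [rho0 th1 th2 e]]]] := ppf_cover W (col2 R 1 1).
have inj s : 0 <= s -> cone (ppf_angles j).1 (ppf_angles j).2 (col2 R s s).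
  move=> s0; exists (s * rho), th; split=> //; first exact: mulr_ge0.
  have e0 := congr1 (fun y : 'cV[R]_2 => y ord0 ord0) e.
  have e1 := congr1 (fun y : 'cV[R]_2 => y ord_max ord0) e.
  rewrite !mxE /= in e0 e1.
  by apply/colP; apply: ord2P; rewrite !mxE /= -mulrA -?e0 -?e1 mulr1.
have [g szg gE] := meval_ray _ _ _ (msize_ppf_poly j).
have WE s : 0 <= s -> W (col2 R s s) = g.[s].
  move=> s0; rewrite (@ppf_polyE _ W j _ (inj s s0)) -gE.
  by apply: meval_eq => i; rewrite mxE; case: ifP.
have gpos s : 0 < s -> 0 < g.[s].
  move=> s0; rewrite -WE ?(ltW s0)//; apply: Wpos.
  apply: contra_neq (lt0r_neq0 s0) => /(congr1 (fun y : 'cV[R]_2 => y ord0 ord0)).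
  by rewrite !mxE.
have [s s0 hs] := polynomial_small_scale R g m r szg gpos r01.
have /andP[r0 _] := r01.
by exists s => //; rewrite !WE ?(ltW s0)// mulr_ge0// ltW.
Qed.
End piecewise.

(** * Choice of the parameters and contradiction *)

Lemma spiral_parameter (R : realType) :
  exists q : R, [/\ 0 < q, q < 1 & q ^+ 4 - 2 * q ^+ 3 - 2 * q + 1 = 0].
Proof.
pose p : {poly R} := - 'X^4 + 2%:P * 'X^3 + 2%:P * 'X - 1.
have pE x : p.[x] = - (x ^+ 4 - 2 * x ^+ 3 - 2 * x + 1).
  by rewrite /p !hornerE; ring.
have p01 : p.[0] <= 0 <= p.[1].
  by rewrite !pE !expr0n !expr1n /=; lra.
have [q /andP[q0 q1] /rootP/eqP] := poly_ivt ler01 p01.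
rewrite pE oppr_eq0 => /eqP qE; exists q; split=> //; rewrite lt_neqAle ?q0 ?q1 andbT.
  by apply/eqP => q00; move: qE; rewrite -q00 !expr0n /=; lra.
by apply/eqP => q10; move: qE; rewrite q10 !expr1n; lra.
Qed.

(** The ratio of the coordinates is e^t whatever [eta] and [s], so the directions sampled on the arc
    can be fixed before these are chosen. *)
Lemma node_flow_polar (R : realType) (eta s t : R) : 0 < s ->
  exists2 rho, 0 < rho & node_flow R eta (col2 R s s) t = polar rho (atan (expR t)).
Proof.
move=> s0; rewrite /node_flow !mxE /=.
have x0 : 0 < expR (- (2 + eta) * t) * s by rewrite mulr_gt0// expR_gt0.
rewrite polar_atan//.
have -> : expR (- (1 + eta) * t) * s / (expR (- (2 + eta) * t) * s) = expR t.
  rewrite invfM mulrACA divff ?gt_eqF// mulr1 -expRN -expRD; congr expR; ring.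
eexists; last by reflexivity.
by rewrite mulr_gt0// sqrtr_gt0 ltr_wpDr ?sqr_ge0.
Qed.

(** Along geometric sequences of points every monomial is geometric, with ratio at most [rho] unless
    it is constant. [geometric_sum_gap] then applies with one term per monomial. *)
Lemma geometric_monomials_gap (R : realType) (k : nat) (p : mpoly.mpoly 2 R) (x y mu nu rho d : R) :
    (msize p <= k)%N -> mcoeff (@mnm0 2) p = 0 ->
    0 <= mu <= rho -> 0 <= nu <= rho -> rho <= 1 ->
    (forall i, (i <= #|{: bmultinom 2 k}|)%N ->
       `|meval (fun j => if j == ord0 then x * mu ^+ i else y * nu ^+ i) p - 1| <= d) ->
  ((1 - rho) / 2) ^+ #|{: bmultinom 2 k}| <= d.
Proof.
move=> pk p0 /andP[mu0 mu1] /andP[nu0 nu1] rho1 fd; set N := #|_| in fd *.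
(* The constant monomial would have ratio 1 and annihilate the product; as its coefficient is 0, its
   ratio may be set to 0. *)
pose g (m : bmultinom 2 k) : R * R := (mcoeff m p * (x ^+ m ord0 * y ^+ m ord_max),
  if val m == @mnm0 2 then 0 else mu ^+ m ord0 * nu ^+ m ord_max).
have gE i : \sum_(q <- [seq g m | m <- index_enum {: bmultinom 2 k}]) q.1 * q.2 ^+ i =
    meval (fun j => if j == ord0 then x * mu ^+ i else y * nu ^+ i) p.
  rewrite big_map (meval_bmultinom _ _ _ _ pk); apply: eq_bigr => m _; rewrite /g /=.
  have [->|m0] := eqVneq (bmnm m) (@mnm0 2); first by rewrite p0 !mul0r.
  by rewrite !exprMn -!exprM ![(i * _)%N]mulnC; ring.
have szN : size [seq g m | m <- index_enum {: bmultinom 2 k}] = N.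
  by rewrite size_map /N cardT enumT.
have rho0 : 0 <= rho by lra.
have g2 m : 0 <= (g m).2 <= rho.
  rewrite /g /=; case: eqVneq => m0; first by rewrite lexx.
  have mu01 : 0 <= mu <= 1 by lra.
  have nu01 : 0 <= nu <= 1 by lra.
  have [pm pn] : (0 <= mu ^+ m ord0 <= 1) /\ (0 <= nu ^+ m ord_max <= 1).
    by split; rewrite exprn_ge0 ?exprn_ile1//; case/andP: mu01 nu01 => ? ? /andP[].
  rewrite mulr_ge0 ?(proj1 (andP pm)) ?(proj1 (andP pn))//=.
  have [m00|m00] := eqVneq (m ord0) 0%N; last first.
    apply: (@le_trans _ _ (mu ^+ m ord0 * 1)); first by rewrite ler_wpM2l; case/andP: pm pn => ? ? /andP[].
    rewrite mulr1 (le_trans _ mu1)// -[leRHS]expr1 ler_wiXn2l//; [by case/andP: mu01|by rewrite lt0n].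
  have m10 : m ord_max != 0%N.
    apply: contra_neq m0 => m10; apply/mnmP => i; rewrite mnm0E.
    by move: i; apply: ord2P.
  rewrite m00 expr0 mul1r (le_trans _ nu1)// -[leRHS]expr1 ler_wiXn2l//; [by case/andP: nu01|by rewrite lt0n].
have := geometric_sum_gap R 1 d [seq g m | m <- index_enum {: bmultinom 2 k}].
rewrite szN normr1 mul1r big_map => gap.
have {}gap : \prod_(m : bmultinom 2 k) (1 - (g m).2) <= 2 ^+ N * d.
  apply: gap => [q /mapP[m _ ->]|i iN].
    by have /andP[-> /le_trans] := g2 m; apply.
  by rewrite gE; exact: fd.
rewrite expr_div_n ler_pdivrMr ?exprn_gt0// [leRHS]mulrC; apply: le_trans gap.
rewrite /N -prodr_const; apply: ler_prod => m _; have := g2 m; lra.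
Qed.

Theorem mainTheorem4 (R : realType) (U : set R)
    (hU : U = `[0, 1]%classic \/ U = [set 0; 1]) :
  ~ exists m : nat, forall A B : 'M[R]_2,
      hurwitz A -> hurwitz B -> GUES U A B ->
      exists V : ppf R, CLF U A B V /\ (total_degree V <= m)%N.
Proof.
(* Both choices of [U] are used only through these three properties. *)
have [U0 U1 U01] : [/\ U 0, U 1 & forall u, U u -> 0 <= u <= 1].
  case: hU => ->; split=> /=; rewrite ?in_itv /= ?lexx ?ler01//; [by left|by right|].
  by move=> u [] ->; rewrite ?lexx ?ler01.
have [q [q0 q1 qE]] := spiral_parameter R.
move=> [m deg_m]; pose tau : R := - ln q.
have tau0 : 0 < tau by rewrite oppr_gt0 ln_lt0// q0.
have qtau : q = expR (- tau) by rewrite opprK lnK.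
(* [N] counts the monomials of degree at most [m]. The m + 1 blocks of [n] steps of length [h] fill
   the duration [tau] of the first arc. *)
pose N := #|{: bmultinom 2 m.+1}|; pose n := N.+1.
have mn0 : 0 < (m.+1 * n)%:R :> R by rewrite ltr0n.
pose h : R := tau / (m.+1 * n)%:R; have h0 : 0 < h by rewrite divr_gt0.
(* The deviation from a constant that the samples cannot avoid; it is independent of [eta]. *)
pose gap : R := ((1 - expR (- h)) / 2) ^+ N.
have gap0 : 0 < gap by rewrite exprn_gt0// divr_gt0// subr_gt0 -expR0 ltr_expR oppr_lt0.
have m0 : 0 < m.+1%:R :> R by rewrite ltr0n.
(* Chosen so that 4 (m + 1) eta tau, which bounds 1 - r^(m+1), equals gap / 2. *)
pose eta : R := gap / (8 * m.+1%:R * tau).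
have eta0 : 0 < eta by rewrite divr_gt0// !mulr_gt0.
have [V [clf Vm]] := deg_m _ _ (hurwitz_node R eta eta0) (hurwitz_turned_node R q q0 q1 eta eta0)
  (GUES_node R q q0 q1 qE U eta U01 eta0).
have [_ V0 Vpos _] := clf.
pose r : R := expR (- (eta * tau)) ^+ 4.
have r01 : 0 < r < 1.
  rewrite exprn_gt0 ?expR_gt0//= exprn_ilt1 ?expR_ge0// -expR0 ltr_expR oppr_lt0.
  exact: mulr_gt0.
have [s s0 ray] := ppf_ray R m V Vm r r01 V0 Vpos.
pose x t := node_flow R eta (col2 R s s) t.
have bounds t : 0 <= t <= tau -> r ^+ m.+1 * V (col2 R s s) <= V (x t) <= V (col2 R s s).
  move=> ht; have /andP[lo hi] := CLF_node_turn R q q0 q1 U eta tau V U0 U1 eta0 qtau clf s t s0 ht.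
  by rewrite hi andbT (le_trans ray).
have c0 : 0 < V (col2 R s s).
  apply: Vpos; apply: contra_neq (lt0r_neq0 s0) => /(congr1 (fun y : 'cV[R]_2 => y ord0 ord0)).
  by rewrite !mxE.
pose phi (k : nat) : R := atan (expR (k%:R * h)).
have phi_le i j : (i <= j)%N -> phi i <= phi j.
  by move=> ij; apply: le_atan; rewrite ler_expR ler_wpM2r ?(ltW h0)// ler_nat.
have phi_pi k : 0 <= phi k < pi.
  rewrite -[X in X <= _]atan0 le_atan ?expR_ge0//= (lt_trans (atan_ltpi2 _))//.
  by rewrite ltr_pdivrMr// ltr_pMr ?pi_gt0// ltr1n.
have [j [k0 [k0n sector]]] : exists (j : 'I_(ppf_ncones V)) k0, (k0 + n <= m.+1 * n)%N /\
    forall i, (i <= n)%N -> exists th, [/\ (ppf_angles j).1 <= th, th < (ppf_angles j).2,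
      cos th = cos (phi (k0 + i)%N) & sin th = sin (phi (k0 + i)%N)].
  apply: common_sector phi_le phi_pi _; first exact: ncones_le.
  move=> k; have [rho rho0 xE] := node_flow_polar R eta s (k%:R * h) s0.
  have [j [rho' [th [rho'0 th1 th2 xE']]]] := ppf_cover V (x (k%:R * h)).
  have [_ [ec es]] := polar_eq R _ _ _ _ rho0 rho'0 (etrans (esym xE) xE').
  by exists j, th; split.
pose c := V (col2 R s s).
(* After division by its value at the start, [V] stays between r^(m+1) and 1 on the arc. *)
have fE i : (i <= N)%N -> `|meval (fun l => if l == ord0
     then x (k0%:R * h) ord0 ord0 * expR (- (2 + eta) * h) ^+ i
     else x (k0%:R * h) ord_max ord0 * expR (- (1 + eta) * h) ^+ i) (c^-1 *: ppf_poly j) - 1| <=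
   1 - r ^+ m.+1.
  move=> iN; have [th [th1 th2 thc ths]] := sector i (leqW iN).
  have -> : (fun l => if l == ord0
     then x (k0%:R * h) ord0 ord0 * expR (- (2 + eta) * h) ^+ i
     else x (k0%:R * h) ord_max ord0 * expR (- (1 + eta) * h) ^+ i) =
     (fun l : 'I_2 => x ((k0 + i)%:R * h) l ord0).
    apply/funext; apply: ord2P; rewrite /x /node_flow !mxE /= -expRM_natl mulrAC -expRD natrD;
      by congr (expR _ * _); ring.
  rewrite mevalZ -(@ppf_polyE _ V j); last first.
    have [rho rho0 xE] := node_flow_polar R eta s ((k0 + i)%:R * h) s0.
    exists rho, th; split=> //; first exact: ltW.
    by rewrite /x xE; apply/colP; apply: ord2P; rewrite !mxE /= ?thc ?ths.
  have /bounds/andP[lo hi] : 0 <= (k0 + i)%:R * h <= tau.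
    rewrite mulr_ge0 ?(ltW h0)//= /h mulrA ler_pdivrMr// mulrC ler_pM2l// ler_nat.
    by rewrite (leq_trans _ k0n)// leq_add2l leqW.
  rewrite mulrC; have lo' : r ^+ m.+1 <= V (x ((k0 + i)%:R * h)) / c by rewrite ler_pdivlMr.
  have hi' : V (x ((k0 + i)%:R * h)) / c <= 1 by rewrite ler_pdivrMr// mul1r.
  rewrite ler_norml; lra.
have p0 : mcoeff (@mnm0 2) (c^-1 *: ppf_poly j) = 0 by rewrite mcoeffZ ppf_poly_at0// mulr0.
have sz : (msize (c^-1 *: ppf_poly j) <= m.+1)%N.
  exact: leq_trans (msizeZ_le _ _) (msize_ppf_poly R m V Vm j).
(* Both decay rates are at least 1, which yields the ratio bound [expR (- h)] uniformly in [eta]. *)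
have expm k : 1 <= k -> 0 <= expR (- k * h) <= expR (- h).
  by move=> k1; rewrite expR_ge0 ler_expR mulNr lerN2 ler_peMl// ltW.
have mu2 := expm (2 + eta) ltac:(lra); have mu1 := expm (1 + eta) ltac:(lra).
have rho1 : expR (- h) <= 1 by rewrite -expR0 ler_expR oppr_le0 ltW.
have := geometric_monomials_gap R m.+1 _ _ _ _ _ _ _ sz p0 mu2 mu1 rho1 fE.
rewrite -/N -/gap.
have : 1 - 4 * m.+1%:R * (eta * tau) <= r ^+ m.+1.
  rewrite /r -exprM -expRM_natl; apply: le_trans (expR_ge1Dx _).
  by rewrite natrM; lra.
have -> : 4 * m.+1%:R * (eta * tau) = gap / 2.
  rewrite /eta; move: m0; set M := m.+1%:R => M0.
  by field; rewrite !gt_eqF.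
lra.
Qed.
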